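(* Let $n\ge0$ be an integer and $x>0$. Then, with the same choice of sign throughout, $$\left.\frac{\partial \mathrm{W}_{\kappa,\mu}(x)}{\partial\mu}\right|_{\kappa=0,\ \mu=\pm(n+1/2)}=\pm\sqrt{\frac{x}{\pi}}\,K_{n+1/2}\left(\frac x2\right)\left[\mathrm{E}_1(x)-H_n\right]\pm e^{-x/2}\sum_{k=0}^{n}\frac{(n+k)!\,x^{-k}}{k!\,(n-k)!}\left\{H_{n+k}+(-1)^{n+k+1}\,\Gamma(-n-k,x)\,\gamma(n+k+1,-x)-\sum_{\ell=1}^{n+k}\binom{n+k}{\ell}(-x)^{-\ell}\gamma(\ell,x)\right\}.$$
   Context: For $x>0$, the Whittaker function is $\mathrm{W}_{\kappa,\mu}(x)=e^{-x/2}x^{\mu+1/2}\,\mathrm{U}\left(\frac12+\mu-\kappa,1+2\mu,x\right)$, where $\mathrm{U}$ is the Tricomi confluent hypergeometric function. $K_\nu$ is the modified Bessel function of the second kind. $\gamma(\nu,z)=\int_0^z t^{\nu-1}e^{-t}\,dt$ ($\mathrm{Re}\,\nu>0$) and $\Gamma(\nu,z)=\int_z^\infty t^{\nu-1}e^{-t}\,dt$ are the lower and upper incomplete gamma functions. $\mathrm{E}_1(x)=\int_x^\infty\frac{e^{-t}}{t}\,dt$ is the exponential integral. $H_k=\sum_{j=1}^k\frac1j$ is the $k$-th harmonic number ($H_0=0$). *)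

(* Defs.v *)
From Stdlib Require Import Reals ClassicalEpsilon.
From Coquelicot Require Import Coquelicot.
Open Scope R_scope.

(** [U(a,b,-)] is the solution of Kummer's equation on (0,+oo) that is
    equivalent to [x^(-a)] at +oo.  This determines it uniquely for all real
    [a], [b]: any solution independent of it grows like [e^x x^(a-b)].  No
    restriction [a > 0] (as in Laplace's integral) is possible here, since
    [a = 1/2 + mu] is negative near [mu = -(n+1/2)] when [n > 0]. *)
Definition is_tricomiU (a b : R) (f : R -> R) : Prop :=
  (forall x : R, 0 < x ->
     ex_derive f x /\ ex_derive (Derive f) x /\
     x * Derive (Derive f) x + (b - x) * Derive f x - a * f x = 0) /\
  is_lim (fun x => Rpower x a * f x) p_infty 1.

Definition tricomiU (a b : R) : R -> R :=
  epsilon (inhabits (fun _ : R => 0)) (is_tricomiU a b).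

Definition whittakerW (kappa mu x : R) : R :=
  exp (- x / 2) * Rpower x (mu + 1 / 2)
  * tricomiU (1 / 2 + mu - kappa) (1 + 2 * mu) x.

(** [K_nu] is the solution of the modified Bessel equation on (0,+oo) that is
    equivalent to [sqrt (PI / (2 x)) e^(-x)] at +oo, which is again unique. *)
Definition is_besselK (nu : R) (f : R -> R) : Prop :=
  (forall x : R, 0 < x ->
     ex_derive f x /\ ex_derive (Derive f) x /\
     x ^ 2 * Derive (Derive f) x + x * Derive f x - (x ^ 2 + nu ^ 2) * f x = 0) /\
  is_lim (fun x => sqrt (2 * x / PI) * exp x * f x) p_infty 1.

Definition besselK (nu : R) : R -> R :=
  epsilon (inhabits (fun _ : R => 0)) (is_besselK nu).

(** [gamma(nu,z)] for an integer order [nu >= 1], so that the integrand makes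
    sense at negative [t]; for [z < 0], [RInt] is the oriented integral. *)
Definition lower_gamma (nu : nat) (z : R) : R :=
  RInt (fun t => t ^ (nu - 1) * exp (- t)) 0 z.

(** [Gamma(nu,z)] for [z > 0] and any real order [nu]. *)
Definition upper_gamma (nu z : R) : R :=
  RInt_gen (fun t => Rpower t (nu - 1) * exp (- t))
    (at_point z) (Rbar_locally p_infty).

Definition expint_E1 (x : R) : R :=
  RInt_gen (fun t => exp (- t) / t) (at_point x) (Rbar_locally p_infty).

Definition harmonic (k : nat) : R := sum_n_m (fun j => / INR j) 1 k.

(* Main.v *)
Require Import Defs.
From Stdlib Require Import Reals Factorial Lra Lia ClassicalEpsilon FunctionalExtensionality.
From Coquelicot Require Import Coquelicot.
Open Scope R_scope.

(** Laplace's integral with [t = e^u] gives, for [a = mu + 1/2 > 0],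
    [W_{0,mu}(x) = e^(-x/2) x^a N(a) / Gamma(a)] with
    [N(a) = int_R exp (- x e^u + a u + (a - 1) ln (1 + e^u)) du].
    Integrands of this kind decay exponentially in [u], so parameters can be
    differentiated under the integral sign by a second order Taylor bound.  At
    [a = n + 1] the factor [(1 + e^u)^n] expands binomially, and [N'(n+1)]
    becomes a combination of the moments [int e^(-xt) t^m ln t dt], which give
    the harmonic numbers, and [int e^(-xt) t^m ln (1+t) dt].  By parts, the
    latter multiplied by [x^(m+1) / m!] grows by [x^m e^x Gamma(-m,x)] from
    [m-1] to [m]; so does the bracket of the theorem, by Pascal's rule and the
    binomial theorem under the integrals [gamma(l,x)].  Since the Wronskian
    argument makes [U] and [K_nu] unique, Kummer's transformation yields
    [W_{0,-mu} = W_{0,mu}], hence the sign. *)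

(** * Integrals over the real line with exponential decay *)

(** The formula rests on a cancellation. Differentiating [x^a N(a) / Gamma(a)] in [a] yields [ln x]
    from the power, while scaling puts [- ln x] into every moment of [ln t]. The logarithmic
    derivative of [Gamma] at [n+1] is [H_n] minus Euler's constant, and that constant also sits in
    every moment of [ln t]. What survives is [H_(n+k) - H_n], so Euler's constant stays an
    unevaluated integral, as does [Gamma(a)], the kernel at [x = 1] without the factor in [1 + t].
    The isolated [E_1(x)] comes from the moment [m = 0] of [ln (1+t)], which is [e^x E_1(x) / x]:
    writing [e^x = 1 + (e^x - 1)] leaves one [E_1(x)] in front of every bracket. It multiplies the
    whole sum, which is [W] itself, hence [K_(n+1/2)]. The obstacle is that [U] and [K] are chosen
    by [epsilon]: nothing is known of them until a solution with the prescribed asymptotics is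
    exhibited and proved unique. The variable [u] makes every parameter enter the exponent linearly,
    so one differentiation lemma serves for both [x] and [a]. *)

Notation minf := (Rbar_locally m_infty).
Notation pinf := (Rbar_locally p_infty).

(** For [s = 1] and [s = -1] the function [G - s * F] has derivative [g - s * f >= 0], so both are
    nondecreasing by the mean value theorem. *)
Lemma increment_dominated (F f G g : R -> R) (a b : R) :
  a <= b ->
  (forall t, a <= t <= b -> is_derive F t (f t) /\ is_derive G t (g t)
                            /\ Rabs (f t) <= g t) ->
  Rabs (F b - F a) <= G b - G a.
Proof.
intros Hab H.
assert (Hi : forall s : R, s = 1 \/ s = -1 -> s * (F b - F a) <= G b - G a).
{ intros s Hs.
  destruct (MVT_gen (fun t => G t - s * F t) a b (fun t => g t - s * f t))
    as [c [Hc Hd]].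
  - intros t Ht. rewrite Rmin_left, Rmax_right in Ht by lra.
    destruct (H t) as [H1 [H2 _]]; [lra|].
    apply (is_derive_minus G (fun t => s * F t)); [exact H2|].
    apply (is_derive_scal F t s); exact H1.
  - intros t Ht. rewrite Rmin_left, Rmax_right in Ht by lra.
    destruct (H t) as [H1 [H2 _]]; [lra|].
    apply derivable_continuous_pt. exists (g t - s * f t).
    apply is_derive_Reals.
    apply (is_derive_minus G (fun t => s * F t)); [exact H2|].
    apply (is_derive_scal F t s); exact H1.
  - rewrite Rmin_left, Rmax_right in Hc by lra.
    destruct (H c Hc) as [_ [_ H3]].
    assert (0 <= g c - s * f c).
    { apply Rabs_le_between in H3. destruct Hs; subst s; lra. }
    assert (0 <= (g c - s * f c) * (b - a)) by (apply Rmult_le_pos; lra).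
    lra. }
assert (H1 := Hi 1 (or_introl eq_refl)).
assert (H2 := Hi (-1) (or_intror eq_refl)).
apply Rabs_le. lra.
Qed.

(** Comparison test for improper integrals, phrased for primitives: the increments of [F] are
    bounded by those of [G], so the Cauchy criterion passes from [G] to [F]. *)
Lemma ex_filterlim_dominated (F f G g : R -> R) (a l : R) :
  (forall t, a <= t -> is_derive F t (f t) /\ is_derive G t (g t)
                       /\ Rabs (f t) <= g t) ->
  filterlim G pinf (locally l) ->
  exists l', filterlim F pinf (locally l').
Proof.
intros H HG.
apply (proj1 (filterlim_locally_cauchy (F := pinf) F)).
intros eps.
destruct (proj2 (filterlim_locally_cauchy (F := pinf) G) (ex_intro _ l HG) eps)
  as [P [[M HP] HPc]].
exists (fun t => a <= t /\ P t). split.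
- exists (Rmax a M). intros t Ht.
  pose proof (Rmax_l a M); pose proof (Rmax_r a M).
  split; [lra|apply HP; lra].
- assert (Hle : forall u v, u <= v -> a <= u -> P u -> P v ->
    Rabs (F v - F u) < eps).
  { intros u v Huv Hu HPu HPv.
    apply Rle_lt_trans with (G v - G u).
    - apply increment_dominated with f g; [exact Huv|].
      intros t Ht; apply H; lra.
    - apply Rle_lt_trans with (Rabs (G v - G u)); [apply Rle_abs|].
      apply (HPc u v HPu HPv). }
  intros u v [Hu HPu] [Hv HPv].
  destruct (Rle_dec u v).
  + apply Hle; auto.
  + apply ball_sym. apply Hle; auto; lra.
Qed.

(** General filters let one statement serve the whole line and the half-line from [at_point x],
    where the limit of [F] is [F x]. The limits [la] and [lb] are the boundary terms when
    integrating by parts over an unbounded interval. *)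
Lemma is_RInt_gen_FTC (Fa Fb : (R -> Prop) -> Prop) {HFa : Filter Fa}
    {HFb : Filter Fb} (F f : R -> R) (la lb : R) :
  filter_prod Fa Fb (fun ab => forall t,
     Rmin (fst ab) (snd ab) <= t <= Rmax (fst ab) (snd ab) ->
     is_derive F t (f t) /\ continuous f t) ->
  filterlim F Fa (locally la) -> filterlim F Fb (locally lb) ->
  is_RInt_gen f Fa Fb (lb - la).
Proof.
intros H Ha Hb.
apply (filterlimi_lim_ext_loc (fun ab : R * R => F (snd ab) - F (fst ab))).
- revert H. apply filter_imp. intros ab Hab.
  apply (is_RInt_derive F f).
  + intros t Ht; apply Hab; exact Ht.
  + intros t Ht; apply Hab; exact Ht.
- apply (filterlim_comp_2 (G := locally lb) (H := locally (- la))
   (fun ab : R * R => F (snd ab)) (fun ab : R * R => - F (fst ab)) Rplus).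
  + apply filterlim_comp with Fb; [apply filterlim_snd|exact Hb].
  + apply filterlim_comp with (locally la);
     [|apply (filterlim_opp (V := R_NormedModule) la)].
    apply filterlim_comp with Fa; [apply filterlim_fst|exact Ha].
  + apply (filterlim_plus (V := R_NormedModule) lb (- la)).
Qed.

Definition is_J (f : R -> R) (v : R) := is_RInt_gen f minf pinf v.
Definition J (f : R -> R) : R := RInt_gen f minf pinf.

Lemma is_J_unique f v : is_J f v -> J f = v.
Proof.
exact (is_RInt_gen_unique (V := R_CompleteNormedModule) (Fa := minf) (Fb := pinf) f v).
Qed.

Lemma is_J_val f v w : is_J f v -> v = w -> is_J f w.
Proof. now intros H <-. Qed.

Lemma is_J_inj f v w : is_J f v -> is_J f w -> v = w.
Proof. intros H1 H2. rewrite <- (is_J_unique f v H1). now apply is_J_unique. Qed.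

Lemma is_J_ext f g v : (forall u, f u = g u) -> is_J f v -> is_J g v.
Proof.
intros H. apply (is_RInt_gen_ext (V := R_NormedModule) (Fa := minf) (Fb := pinf) f g v).
apply filter_forall. intros ab u _; apply H.
Qed.

Lemma is_J_plus f g v w : is_J f v -> is_J g w -> is_J (fun u => f u + g u) (v + w).
Proof. exact (is_RInt_gen_plus (Fa := minf) (Fb := pinf) f g v w). Qed.

Lemma is_J_scal f k v : is_J f v -> is_J (fun u => k * f u) (k * v).
Proof. exact (is_RInt_gen_scal (Fa := minf) (Fb := pinf) f k v). Qed.

Lemma is_J_minus f g v w : is_J f v -> is_J g w -> is_J (fun u => f u - g u) (v - w).
Proof. exact (is_RInt_gen_minus (Fa := minf) (Fb := pinf) f g v w). Qed.

Lemma filter_prod_infty (P : R -> R -> Prop) :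
  (forall a b, a < 0 -> 1 < b -> P a b) ->
  filter_prod minf pinf (fun ab => P (fst ab) (snd ab)).
Proof.
intros H. exists (fun a => a < 0) (fun b => 1 < b).
- now exists 0.
- now exists 1.
- intros a b Ha Hb; now apply H.
Qed.

Lemma is_J_norm_le f g v w :
  (forall u, Rabs (f u) <= g u) -> is_J f v -> is_J g w -> Rabs v <= w.
Proof.
intros H Hf Hg.
apply (RInt_gen_norm (V := R_CompleteNormedModule) (Fa := minf) (Fb := pinf) f g).
- apply (filter_prod_infty (fun a b => a <= b)). intros; lra.
- apply filter_forall. intros ab u _. apply H.
- exact Hf.
- exact Hg.
Qed.

(** Every interval containing [[0, 1]] carries at least the integral over [[0, 1]], which is
    strictly positive. Strictness later allows division by [Gamma(a)]. *)
Lemma is_J_pos f v :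
  (forall u, 0 < f u) -> (forall u, continuous f u) -> is_J f v -> 0 < v.
Proof.
intros Hp Hc Hv.
assert (H01 : 0 < RInt f 0 1).
{ apply RInt_gt_0; [lra| |]; intros; auto. }
destruct (Rlt_dec 0 v) as [|Hn]; [assumption|exfalso].
(* With this gap as tolerance, some interval around [[0, 1]] would have an integral below
   [RInt f 0 1]. *)
assert (He : 0 < RInt f 0 1 - v) by lra.
apply filterlimi_locally with (eps := mkposreal _ He) in Hv.
destruct (filter_ex _ (filter_and _ _ Hv
   (filter_prod_infty (fun a b => a < 0 /\ 1 < b) (fun a b h1 h2 => conj h1 h2))))
  as [[a b] [[z [Hz Hb]] [Ha0 Hb1]]]; simpl in *.
assert (Hex : forall p q, ex_RInt f p q).
{ intros p q. apply (ex_RInt_continuous (V := R_CompleteNormedModule)).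
  intros; apply Hc. }
assert (Hz' : z = RInt f a b) by (symmetry; now apply is_RInt_unique).
assert (Hz2 : z = RInt f a 0 + RInt f 0 1 + RInt f 1 b).
{ rewrite Hz'. rewrite <- (RInt_Chasles f a 0 b), <- (RInt_Chasles f 0 1 b);
   auto. unfold plus; simpl. lra. }
assert (0 <= RInt f a 0) by (apply RInt_ge_0; [lra|auto|intros; left; auto]).
assert (0 <= RInt f 1 b) by (apply RInt_ge_0; [lra|auto|intros; left; auto]).
unfold ball in Hb; simpl in Hb; unfold AbsRing_ball, abs, minus, plus, opp in Hb;
 simpl in Hb.
apply Rabs_lt_between in Hb. lra.
Qed.

Lemma filterlim_plus_cst_infty (c : R) (y : Rbar) :
  y = p_infty \/ y = m_infty ->
  filterlim (fun a => a + c) (Rbar_locally y) (Rbar_locally y).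
Proof.
intros [-> | ->] P [M HM]; exists (M - c); intros t Ht; apply HM; lra.
Qed.

Lemma exp_monotone x y : x <= y -> exp x <= exp y.
Proof.
intros [H| ->]; [left; now apply exp_increasing|apply Rle_refl].
Qed.

(** In the variable [t = exp u] this is a scaling of [t]; with [c = - ln x] it separates the
    dependence on [x] from the integrals. *)
Lemma is_J_translate f c v : is_J f v -> is_J (fun u => f (u + c)) v.
Proof.
intros H.
assert (H2 : is_RInt_gen (fun u => f (u + c)) minf pinf v).
{ unfold is_RInt_gen in *.
  apply (filterlimi_ext (fun ab : R * R => is_RInt f (fst ab + c) (snd ab + c))).
  - intros [a b] y; simpl. split; intros Hy.
    + apply is_RInt_ext with (fun u => scal 1 (f (1 * u + c))).
      * intros u _. unfold scal; simpl; unfold mult; simpl.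
        rewrite !Rmult_1_l; reflexivity.
      * apply (is_RInt_comp_lin f 1 c a b y). rewrite !Rmult_1_l. exact Hy.
    + apply is_RInt_ext with
        (fun u => scal 1 ((fun u => f (u + c)) (1 * u + (- c)))).
      * intros u _. unfold scal; simpl; unfold mult; simpl.
        rewrite !Rmult_1_l. f_equal; ring.
      * apply (is_RInt_comp_lin (fun u => f (u + c)) 1 (- c) (a + c) (b + c) y).
        replace (1 * (a + c) + - c) with a by ring.
        replace (1 * (b + c) + - c) with b by ring.
        exact Hy.
  - apply (filterlimi_comp_2 (G := minf) (H := pinf) (fun ab : R * R => fst ab + c) (fun ab => snd ab + c)
      (fun a b => is_RInt f a b)).
    + apply (filterlim_comp _ _ _ fst (fun a => a + c) _ minf); [apply filterlim_fst|].
      apply filterlim_plus_cst_infty; now right.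
    + apply (filterlim_comp _ _ _ snd (fun a => a + c) _ pinf); [apply filterlim_snd|].
      apply filterlim_plus_cst_infty; now left.
    + exact H. }
exact H2.
Qed.

(** Since the rate [d] may shrink, the class is stable under factors of linear growth, such as the
    [u] and [softplus u] that differentiation in [a] brings down. *)
Definition Dom (f : R -> R) : Prop :=
  exists C d, 0 < d /\ forall u, Rabs (f u) <= C * exp (- d * Rabs u).

Lemma filterlim_exp_decay (k d : R) :
  0 < d -> filterlim (fun t => k * exp (- d * t)) pinf (locally 0).
Proof.
intros Hd.
assert (H : is_lim (fun t => k * exp (- d * t)) p_infty (k * 0)).
{ apply (is_lim_scal_l (fun t => exp (- d * t)) k p_infty 0).
  apply is_lim_comp with m_infty.
  - exact is_lim_exp_m.
  - assert (H := is_lim_scal_l (fun t => t) (- d) p_infty p_infty (is_lim_id _)).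
    replace m_infty with (Rbar_mult (- d) p_infty); [exact H|].
    simpl. destruct (Rle_dec 0 (- d)); [exfalso; lra|reflexivity].
  - exists 0; intros; discriminate. }
rewrite Rmult_0_r in H. exact H.
Qed.

Lemma ex_filterlim_Dom (F f : R -> R) :
  (forall t, is_derive F t (f t)) -> Dom f -> exists l, filterlim F pinf (locally l).
Proof.
intros HF [C [d [Hd HC]]].
apply (ex_filterlim_dominated F f (fun t => - C / d * exp (- d * t))
   (fun t => C * exp (- d * t)) 0 0).
- intros t Ht. split; [|split].
  + apply HF.
  + auto_derive; [exact I|]. field. lra.
  + rewrite <- (Rabs_pos_eq t Ht) at 2. apply HC.
- now apply filterlim_exp_decay.
Qed.

Lemma ex_J f : (forall u, continuous f u) -> Dom f -> exists v, is_J f v.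
Proof.
intros Hc HD.
assert (HF : forall t, is_derive (fun t => RInt f 0 t) t (f t)).
{ intros t. apply (is_derive_RInt f (fun t => RInt f 0 t) 0 t); [|apply Hc].
  apply filter_forall. intros b. apply (RInt_correct f 0 b).
  apply (ex_RInt_continuous (V := R_CompleteNormedModule)). intros; apply Hc. }
destruct (ex_filterlim_Dom _ _ HF HD) as [lb Hb].
(* The limit at [m_infty] is that of the reflected primitive at [p_infty]. *)
destruct (ex_filterlim_Dom (fun t => RInt f 0 (- t)) (fun t => - f (- t)))
  as [la Ha].
- intros t.
  replace (- f (- t)) with (scal (-1) (f (- t))).
  2:{ unfold scal; simpl; unfold mult; simpl. ring. }
  apply (is_derive_comp (fun s => RInt f 0 s) Ropp); [apply HF|].
  auto_derive; [exact I|ring].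
- destruct HD as [C [d [Hd HD]]]. exists C, d. split; [exact Hd|].
  intros u. rewrite Rabs_Ropp, <- (Rabs_Ropp u). apply HD.
- exists (lb - la).
  apply (is_RInt_gen_FTC minf pinf (fun t => RInt f 0 t)).
  + apply filter_forall. intros ab t _. split; [apply HF|apply Hc].
  + apply filterlim_ext with (fun t => RInt f 0 (- (- t))).
    { intros t. now rewrite Ropp_involutive. }
    apply (filterlim_comp _ _ _ Ropp (fun t => RInt f 0 (- t)) minf pinf);
      [|exact Ha].
    intros P [M HM]. exists (- M). intros t Ht. apply HM. lra.
  + exact Hb.
Qed.

Lemma J_correct f : (forall u, continuous f u) -> Dom f -> is_J f (J f).
Proof.
intros Hc HD. destruct (ex_J f Hc HD) as [v Hv].
now rewrite (is_J_unique f v Hv).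
Qed.

Lemma Dom_le f g : (forall u, Rabs (f u) <= Rabs (g u)) -> Dom g -> Dom f.
Proof.
intros H [C [d [Hd HC]]]. exists C, d. split; [exact Hd|].
intros u. eapply Rle_trans; [apply H|apply HC].
Qed.

Lemma Dom_ext f g : (forall u, f u = g u) -> Dom g -> Dom f.
Proof. intros H. apply Dom_le. intros u; rewrite H; apply Rle_refl. Qed.

Lemma Dom_scal k f : Dom f -> Dom (fun u => k * f u).
Proof.
intros [C [d [Hd HC]]]. exists (Rabs k * C), d. split; [exact Hd|].
intros u. rewrite Rabs_mult, Rmult_assoc.
apply Rmult_le_compat_l; [apply Rabs_pos|apply HC].
Qed.

Lemma Dom_mul_linear h K f :
  (forall u, Rabs (h u) <= K * (1 + Rabs u)) -> Dom f -> Dom (fun u => h u * f u).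
Proof.
intros Hh [C [d [Hd HC]]].
assert (HK : 0 <= K).
{ generalize (Hh 0) (Rabs_pos (h 0)). rewrite Rabs_R0. lra. }
assert (HCp : 0 <= C).
{ generalize (HC 0) (Rabs_pos (f 0)). rewrite Rabs_R0, Rmult_0_r, exp_0. lra. }
(* Half of the decay rate pays for the factor: [1 + y <= exp y] at [y = d / 2 * Rabs u] bounds
   [(1 + Rabs u) * exp (- y)] by [1 + 2 / d]. *)
exists (K * (1 + 2 / d) * C), (d / 2). split; [lra|].
intros u. rewrite Rabs_mult.
assert (Hu := Rabs_pos u).
set (E := exp (- (d / 2) * Rabs u)).
assert (HE : exp (- d * Rabs u) = E * E).
{ unfold E. rewrite <- exp_plus. f_equal. field. }
assert (H1 : (1 + Rabs u) * E <= 1 + 2 / d).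
{ assert (Hi : E * exp (d / 2 * Rabs u) = 1).
  { unfold E. rewrite <- exp_plus, <- exp_0. f_equal. ring. }
  assert (Hx : 1 + d / 2 * Rabs u <= exp (d / 2 * Rabs u)) by apply exp_ineq1_le.
  assert (H2d : 0 < 2 / d) by (apply Rdiv_lt_0_compat; lra).
  assert (H3 : 1 + Rabs u <= (1 + 2 / d) * exp (d / 2 * Rabs u)).
  { apply Rle_trans with ((1 + 2 / d) * (1 + d / 2 * Rabs u)).
    - replace ((1 + 2 / d) * (1 + d / 2 * Rabs u)) with
        (1 + 2 / d + d / 2 * Rabs u + Rabs u) by (field; lra).
      assert (0 <= d / 2 * Rabs u) by (apply Rmult_le_pos; lra). lra.
    - apply Rmult_le_compat_l; lra. }
  replace (1 + 2 / d) with ((1 + 2 / d) * (E * exp (d / 2 * Rabs u)))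
    by (rewrite Hi; ring).
  assert (0 < E) by apply exp_pos. nra. }
specialize (HC u). rewrite HE in HC.
assert (HEp : 0 < E) by apply exp_pos.
apply Rle_trans with (K * (1 + Rabs u) * (C * (E * E))).
- apply Rmult_le_compat; auto using Rabs_pos.
- replace (K * (1 + Rabs u) * (C * (E * E))) with
    ((K * C * E) * ((1 + Rabs u) * E)) by ring.
  replace (K * (1 + 2 / d) * C * E) with ((K * C * E) * (1 + 2 / d)) by ring.
  apply Rmult_le_compat_l; [|exact H1].
  apply Rmult_le_pos; [|lra]. now apply Rmult_le_pos.
Qed.

Lemma Dom_filterlim f : Dom f ->
  filterlim f minf (locally 0) /\ filterlim f pinf (locally 0).
Proof.
intros [C [d [Hd HC]]].
assert (H := filterlim_exp_decay C d Hd).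
assert (HS : forall eps : posreal, exists M, 0 <= M /\
   forall t, M < Rabs t -> Rabs (f t) < eps).
{ intros eps.
  destruct (H (fun y => Rabs y < eps)) as [M HM].
  - exists eps. intros y Hy. unfold ball in Hy; simpl in Hy.
    unfold AbsRing_ball, abs, minus, plus, opp in Hy; simpl in Hy.
    now rewrite Ropp_0, Rplus_0_r in Hy.
  - exists (Rmax 0 M). split; [apply Rmax_l|]. intros t Ht.
    pose proof (Rmax_r 0 M).
    eapply Rle_lt_trans; [apply HC|].
    eapply Rle_lt_trans; [apply Rle_abs|]. apply HM. lra. }
assert (Hball : forall (eps : posreal) y, Rabs y < eps -> ball 0 eps y).
{ intros eps y Hy. unfold ball; simpl.
  unfold AbsRing_ball, abs, minus, plus, opp; simpl.
  now rewrite Ropp_0, Rplus_0_r. }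
split; apply filterlim_locally; intros eps; destruct (HS eps) as [M [HM0 HM]].
- exists (- M). intros t Ht. apply Hball, HM. rewrite Rabs_left; lra.
- exists M. intros t Ht. apply Hball, HM. rewrite Rabs_pos_eq; lra.
Qed.

Lemma is_J_derive_Dom (F f : R -> R) :
  (forall t, is_derive F t (f t)) -> (forall t, continuous f t) -> Dom F ->
  is_J f 0.
Proof.
intros HF Hc HD. destruct (Dom_filterlim F HD) as [H1 H2].
apply is_J_val with (0 - 0); [|ring].
apply (is_RInt_gen_FTC minf pinf F f 0 0); [|exact H1|exact H2].
apply filter_forall. intros ab t _. split; auto.
Qed.

(** * The kernel of Laplace's integral *)

Definition softplus (u : R) : R := ln (1 + exp u).

(** With [t = exp u], [kern x a c u du] is [exp (- x t) t^(a-1) (1+t)^c dt]. For positive [x] and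
    [a], [c = 0] gives [Gamma(a) / x^a] and [c = b - a - 1] gives [Gamma(a) U(a,b,x)]. *)
Definition kern (x a c u : R) : R := exp (- x * exp u + a * u + c * softplus u).

Lemma one_plus_exp_pos u : 0 < 1 + exp u.
Proof. generalize (exp_pos u); lra. Qed.

Lemma exp_softplus u : exp (softplus u) = 1 + exp u.
Proof. apply exp_ln, one_plus_exp_pos. Qed.

Lemma ln_1p_le y : -1 < y -> ln (1 + y) <= y.
Proof.
intros Hy. rewrite <- (ln_exp y) at 2.
apply ln_le; [lra|apply exp_ineq1_le].
Qed.

Lemma ln_1p_ge0 y : 0 <= y -> 0 <= ln (1 + y).
Proof.
intros Hy. rewrite <- ln_1. apply ln_le; lra.
Qed.

Lemma softplus_ge0 u : 0 <= softplus u.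
Proof. apply ln_1p_ge0. left; apply exp_pos. Qed.

Lemma softplus_le_exp u : softplus u <= exp u.
Proof. apply ln_1p_le. generalize (exp_pos u); lra. Qed.

Lemma softplus_le u : softplus u <= 1 + Rabs u.
Proof.
destruct (Rle_dec 0 u) as [Hu|Hu].
- rewrite (Rabs_pos_eq u Hu). rewrite <- (ln_exp (1 + u)).
  apply ln_le; [apply one_plus_exp_pos|].
  rewrite exp_plus. assert (1 + 1 <= exp 1) by apply exp_ineq1_le.
  assert (1 <= exp u) by (rewrite <- exp_0; now apply exp_monotone). nra.
- apply Rle_trans with (exp u); [apply softplus_le_exp|].
  assert (exp u <= exp 0) by (apply exp_monotone; lra).
  rewrite exp_0 in H. generalize (Rabs_pos u); lra.
Qed.

Lemma is_derive_softplus u : is_derive softplus u (exp u / (1 + exp u)).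
Proof.
unfold softplus. assert (H := one_plus_exp_pos u).
auto_derive; [exact H|]. field. lra.
Qed.

Lemma is_derive_kern x a c u :
  is_derive (kern x a c) u
    ((- x * exp u + a + c * (exp u / (1 + exp u))) * kern x a c u).
Proof.
unfold kern, softplus. assert (H := one_plus_exp_pos u).
auto_derive; [exact H|]. field. lra.
Qed.

Lemma is_derive_continuous (f : R -> R) (u l : R) : is_derive f u l -> continuous f u.
Proof. intros H. apply (ex_derive_continuous f u). now exists l. Qed.

Lemma continuous_kern x a c u : continuous (kern x a c) u.
Proof. eapply is_derive_continuous, is_derive_kern. Qed.

Lemma continuous_softplus u : continuous softplus u.
Proof. eapply is_derive_continuous, is_derive_softplus. Qed.

Lemma kern_pos x a c u : 0 < kern x a c u.
Proof. apply exp_pos. Qed.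

Lemma Dom_kern x a c : 0 < x -> 0 < a -> Dom (kern x a c).
Proof.
(* In [K], one [a] is for the term [a * u], one for the decay rate [a] claimed at [+oo], and
   [Rabs c] comes from [softplus u <= 1 + u]. *)
intros Hx Ha. set (K := 2 * a + Rabs c).
exists (exp (K ^ 2 / x + Rabs c)), a. split; [exact Ha|]. intros u.
rewrite Rabs_pos_eq by (left; apply kern_pos).
unfold kern. rewrite <- exp_plus. apply exp_monotone.
assert (Hc := Rabs_pos c).
assert (HcL : c * softplus u <= Rabs c * softplus u)
  by (apply Rmult_le_compat_r; [apply softplus_ge0|apply Rle_abs]).
assert (HK0 : 0 <= K ^ 2 / x)
  by (apply Rdiv_le_0_compat; [apply pow2_ge_0|exact Hx]).
destruct (Rle_dec 0 u) as [Hu|Hu].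
- rewrite (Rabs_pos_eq u Hu).
  assert (HL := softplus_le u). rewrite (Rabs_pos_eq u Hu) in HL.
  assert (Rabs c * softplus u <= Rabs c * (1 + u)) by (now apply Rmult_le_compat_l).
  assert (He : u ^ 2 / 4 <= exp u).
  { replace u with (u / 2 + u / 2) at 2 by field. rewrite exp_plus.
    assert (1 + u / 2 <= exp (u / 2)) by apply exp_ineq1_le. nra. }
  assert (x * (u ^ 2 / 4) <= x * exp u) by (apply Rmult_le_compat_l; lra).
  (* Completing the square: the quadratic lower bound of [x * exp u] absorbs the linear term at the
     cost of [K ^ 2 / x]. *)
  assert (Hq : K * u <= x * (u ^ 2 / 4) + K ^ 2 / x).
  { assert (0 <= (x * u / 2 - K) ^ 2 / x)
      by (apply Rdiv_le_0_compat; [apply pow2_ge_0|exact Hx]).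
    replace ((x * u / 2 - K) ^ 2 / x) with
      (x * (u ^ 2 / 4) + K ^ 2 / x - K * u) in H1 by (field; lra).
    lra. }
  unfold K in Hq at 1. nra.
- rewrite (Rabs_left u) by lra.
  assert (Hs := softplus_le_exp u).
  assert (exp u <= 1) by (rewrite <- exp_0; apply exp_monotone; lra).
  assert (Rabs c * softplus u <= Rabs c * 1) by (apply Rmult_le_compat_l; lra).
  assert (0 <= x * exp u) by (apply Rmult_le_pos; [lra|left; apply exp_pos]).
  lra.
Qed.

Lemma J_kern_correct x a c : 0 < x -> 0 < a -> is_J (kern x a c) (J (kern x a c)).
Proof.
intros Hx Ha. apply J_correct; [intros; apply continuous_kern|now apply Dom_kern].
Qed.

Lemma J_kern_pos x a c : 0 < x -> 0 < a -> 0 < J (kern x a c).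
Proof.
intros Hx Ha. apply (is_J_pos (kern x a c)).
- intros; apply kern_pos.
- intros; apply continuous_kern.
- now apply J_kern_correct.
Qed.

(** * Differentiation under the integral sign and Kummer's equation *)

Lemma exp_taylor2 y : Rabs (exp y - 1 - y) <= y ^ 2 * exp (Rabs y).
Proof.
assert (H1 : 1 + y <= exp y) by apply exp_ineq1_le.
assert (H2 : 1 - y <= exp (- y)) by (apply (exp_ineq1_le (- y))).
assert (Hi : exp y * exp (- y) = 1)
  by (rewrite <- exp_plus, <- exp_0; f_equal; ring).
assert (H3 := exp_pos y).
assert (H4 : exp y - 1 <= y * exp y) by nra.
rewrite Rabs_pos_eq by lra.
(* By [H4] the remainder is at most [y * (exp y - 1)], and the second factor is controlled by [H4]
   or by [H1] according to the sign of [y]. *)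
destruct (Rle_dec 0 y) as [Hy|Hy].
- rewrite Rabs_pos_eq by lra. nra.
- assert (1 <= exp (Rabs y))
    by (rewrite <- exp_0; apply exp_monotone, Rabs_pos). nra.
Qed.

Lemma is_derive_of_quadratic_bound (f : R -> R) (a l h0 M : R) :
  0 < h0 ->
  (forall h, Rabs h <= h0 -> Rabs (f (a + h) - f a - h * l) <= h ^ 2 * M) ->
  is_derive f a l.
Proof.
intros Hh0 H. apply is_derive_Reals. intros eps Heps.
assert (HM : 0 <= M).
{ specialize (H h0). rewrite Rabs_pos_eq in H by lra.
  specialize (H (Rle_refl _)). assert (0 < h0 ^ 2) by (apply pow_lt; lra).
  generalize (Rabs_pos (f (a + h0) - f a - h0 * l)); intros. nra. }
(* The [+ 1] keeps the denominator positive when [M = 0]. *)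
assert (Hd : 0 < Rmin h0 (eps / (M + 1))).
{ apply Rmin_glb_lt; [exact Hh0|]. apply Rdiv_lt_0_compat; lra. }
exists (mkposreal _ Hd). intros h Hn Hh. simpl in Hh.
assert (Hh1 : Rabs h <= h0) by (generalize (Rmin_l h0 (eps / (M + 1))); lra).
assert (Hh2 : Rabs h < eps / (M + 1))
  by (generalize (Rmin_r h0 (eps / (M + 1))); lra).
specialize (H h Hh1).
assert (Hp : 0 < Rabs h) by now apply Rabs_pos_lt.
replace ((f (a + h) - f a) / h - l) with ((f (a + h) - f a - h * l) / h)
  by (field; exact Hn).
unfold Rdiv. rewrite Rabs_mult, Rabs_inv.
apply Rmult_lt_reg_r with (Rabs h); [exact Hp|].
rewrite Rmult_assoc, Rinv_l by lra. rewrite Rmult_1_r.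
eapply Rle_lt_trans; [exact H|].
rewrite <- (pow2_abs h).
assert (Rabs h * (M + 1) < eps).
{ apply (Rmult_lt_compat_r (M + 1)) in Hh2; [|lra].
  unfold Rdiv in Hh2. rewrite Rmult_assoc, Rinv_l in Hh2; lra. }
simpl. nra.
Qed.

(** The integrand at [a + h] is that at [a] times [exp (h * phi u)]. Hence the second order
    remainder is at most [h ^ 2] times a majorant independent of [h]: [phi ^ 2] times the sum of the
    integrands at [a + h0] and [a - h0], with integrals [Mp] and [Mm]. *)
Lemma is_derive_J_exp (A phi : R -> R) (a h0 : R) :
  0 < h0 ->
  (forall u, continuous A u) -> (forall u, continuous phi u) ->
  (forall h, Rabs h <= h0 -> Dom (fun u => exp (A u + (a + h) * phi u))) ->
  (forall h, Rabs h <= h0 -> Dom (fun u => phi u * exp (A u + (a + h) * phi u))) ->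
  (forall h, Rabs h <= h0 ->
     Dom (fun u => phi u * (phi u * exp (A u + (a + h) * phi u)))) ->
  is_derive (fun a => J (fun u => exp (A u + a * phi u))) a
    (J (fun u => phi u * exp (A u + a * phi u))).
Proof.
intros Hh0 HA Hphi D0 D1 D2.
set (f := fun h u => exp (A u + (a + h) * phi u)).
assert (Hf : forall h u, continuous (f h) u).
{ intros h u. unfold f.
  apply (continuous_comp (fun u => A u + (a + h) * phi u) exp);
    [|apply (ex_derive_continuous exp)].
  - apply (continuous_plus A (fun u => (a + h) * phi u)); [apply HA|].
    apply (continuous_scal_r (a + h) phi). apply Hphi.
  - auto_derive; exact I. }
assert (Hf1 : forall h u, continuous (fun u => phi u * f h u) u).
{ intros h u. apply (continuous_mult phi (f h)); [apply Hphi|apply Hf]. }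
assert (Hf2 : forall h u, continuous (fun u => phi u * (phi u * f h u)) u).
{ intros h u. apply (continuous_mult phi (fun u => phi u * f h u));
   [apply Hphi|apply Hf1]. }
assert (Ha0 : Rabs 0 <= h0) by (rewrite Rabs_R0; lra).
assert (Hap : Rabs h0 <= h0) by (rewrite Rabs_pos_eq; lra).
assert (Ham : Rabs (- h0) <= h0) by (rewrite Rabs_Ropp, Rabs_pos_eq; lra).
assert (Hext : forall u, f 0 u = exp (A u + a * phi u)).
{ intros u. unfold f. now rewrite Rplus_0_r. }
assert (Jl : is_J (fun u => phi u * f 0 u) (J (fun u => phi u * exp (A u + a * phi u)))).
{ destruct (ex_J _ (Hf1 0) (D1 0 Ha0)) as [v Hv].
  apply is_J_val with v; [exact Hv|]. symmetry. apply is_J_unique.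
  apply (is_J_ext (fun u => phi u * f 0 u)); [|exact Hv].
  intros u. now rewrite Hext. }
assert (Jf : forall h, Rabs h <= h0 ->
  is_J (f h) (J (fun u => exp (A u + (a + h) * phi u)))).
{ intros h Hh. apply J_correct; [apply Hf|apply D0, Hh]. }
destruct (ex_J _ (Hf2 h0) (D2 h0 Hap)) as [Mp HMp].
destruct (ex_J _ (Hf2 (- h0)) (D2 (- h0) Ham)) as [Mm HMm].
apply is_derive_of_quadratic_bound with h0 (Mp + Mm); [exact Hh0|].
intros h Hh.
apply is_J_norm_le with
  (fun u => f h u - f 0 u - h * (phi u * f 0 u))
  (fun u => h ^ 2 * (phi u * (phi u * f h0 u) + phi u * (phi u * f (- h0) u))).
- intros u.
  assert (Hs : forall k, f k u = f 0 u * exp (k * phi u)).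
  { intros k. unfold f. rewrite <- exp_plus. f_equal. ring. }
  rewrite (Hs h), (Hs h0), (Hs (- h0)).
  assert (H0 : 0 < f 0 u) by apply exp_pos.
  replace (f 0 u * exp (h * phi u) - f 0 u - h * (phi u * f 0 u)) with
    (f 0 u * (exp (h * phi u) - 1 - h * phi u)) by ring.
  rewrite Rabs_mult, (Rabs_pos_eq (f 0 u)) by lra.
  replace (h ^ 2 * (phi u * (phi u * (f 0 u * exp (h0 * phi u))) +
     phi u * (phi u * (f 0 u * exp (- h0 * phi u))))) with
    (f 0 u * ((h * phi u) ^ 2 * (exp (h0 * phi u) + exp (- h0 * phi u)))) by ring.
  apply Rmult_le_compat_l; [lra|].
  eapply Rle_trans; [apply exp_taylor2|].
  apply Rmult_le_compat_l; [apply pow2_ge_0|].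
  assert (Rabs (h * phi u) <= h0 * Rabs (phi u)).
  { rewrite Rabs_mult. apply Rmult_le_compat_r; [apply Rabs_pos|exact Hh]. }
  (* According to the sign of [phi u], this is one of the two exponentials on the right. *)
  apply Rle_trans with (exp (h0 * Rabs (phi u))); [now apply exp_monotone|].
  generalize (exp_pos (h0 * phi u)) (exp_pos (- h0 * phi u)); intros.
  destruct (Rle_dec 0 (phi u)).
  + rewrite Rabs_pos_eq by lra. lra.
  + rewrite Rabs_left by lra.
    replace (h0 * - phi u) with (- h0 * phi u) by ring. lra.
- apply is_J_minus.
  + apply is_J_minus; [now apply Jf|].
    apply (is_J_ext (f 0)); [reflexivity|].
    apply is_J_val with (J (fun u => exp (A u + (a + 0) * phi u))); [now apply Jf|].
    now rewrite Rplus_0_r.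
  + now apply is_J_scal.
- apply is_J_scal, is_J_plus; assumption.
Qed.

Lemma J_eq f g : (forall u, f u = g u) -> J f = J g.
Proof. intros H. f_equal. now apply functional_extensionality. Qed.

(** Here [phi u = - exp u] grows too fast for [Dom_mul_linear], but multiplication by [exp u] merely
    raises [a] by one, so the integrands stay in the family [kern]. *)
Lemma is_derive_J_kern_x x a c :
  0 < x -> 0 < a ->
  is_derive (fun x => J (kern x a c)) x (- J (kern x (a + 1) c)).
Proof.
intros Hx Ha.
assert (Hk : forall y b u, exp (b * u + c * softplus u + y * - exp u) = kern y b c u).
{ intros y b u. unfold kern. f_equal. ring. }
assert (Hk1 : forall y b u, - exp u * kern y b c u = - 1 * kern y (b + 1) c u).
{ intros y b u. unfold kern.
  replace (- y * exp u + (b + 1) * u + c * softplus u) with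
    (u + (- y * exp u + b * u + c * softplus u)) by ring.
  rewrite (exp_plus u). ring. }
assert (HJ : - J (kern x (a + 1) c) =
  J (fun u => - exp u * exp (a * u + c * softplus u + x * - exp u))).
{ rewrite (J_eq (fun u => - exp u * _) (fun u => - 1 * kern x (a + 1) c u)).
  - symmetry. apply is_J_unique.
    apply is_J_val with (- 1 * J (kern x (a + 1) c)); [|ring].
    apply is_J_scal, J_kern_correct; lra.
  - intros u. now rewrite Hk, Hk1. }
rewrite HJ.
apply is_derive_ext with
  (fun x => J (fun u => exp (a * u + c * softplus u + x * - exp u))).
{ intros t. apply J_eq, Hk. }
assert (Hpos : forall h, Rabs h <= x / 2 -> 0 < x + h).
{ intros h Hh. apply Rabs_le_between in Hh. lra. }
apply (is_derive_J_exp (fun u => a * u + c * softplus u) (fun u => - exp u) x (x / 2)).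
- lra.
- intros u. apply (continuous_plus (fun u => a * u) (fun u => c * softplus u)).
  + apply (ex_derive_continuous (fun u => a * u)). auto_derive; exact I.
  + apply (continuous_scal_r c softplus), continuous_softplus.
- intros u. apply (ex_derive_continuous (fun u => - exp u)). auto_derive; exact I.
- intros h Hh. apply Dom_ext with (kern (x + h) a c); [intros u; apply Hk|].
  apply Dom_kern; auto.
- intros h Hh. apply Dom_ext with (fun u => -1 * kern (x + h) (a + 1) c u).
  { intros u. now rewrite Hk, Hk1. }
  apply Dom_scal, Dom_kern; [auto|lra].
- intros h Hh. apply Dom_ext with (kern (x + h) (a + 1 + 1) c).
  { intros u. rewrite Hk, Hk1, <- Rmult_assoc, (Rmult_comm _ (-1)), Rmult_assoc, Hk1. ring. }
  apply Dom_kern; [auto|lra].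
Qed.

(** The factor [e] ties [c] to [a]: [e = 1] is the numerator of Laplace's integral for [b = 2 * a],
    since then [b - a - 1 = a - 1], and [e = 0] with [x = 1] is [Gamma(a)]. *)
Lemma is_derive_J_kern_a x a e :
  0 < x -> 0 < a ->
  is_derive (fun a => J (kern x a (e * (a - 1)))) a
    (J (fun u => (u + e * softplus u) * kern x a (e * (a - 1)) u)).
Proof.
intros Hx Ha.
assert (Hk : forall b u, exp (- x * exp u - e * softplus u + b * (u + e * softplus u))
  = kern x b (e * (b - 1)) u).
{ intros b u. unfold kern. f_equal. ring. }
rewrite (J_eq (fun u => (u + e * softplus u) * kern x a (e * (a - 1)) u) (fun u => (u + e * softplus u) *
   exp (- x * exp u - e * softplus u + a * (u + e * softplus u)))).
2:{ intros u. now rewrite Hk. }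
apply is_derive_ext with
  (fun a => J (fun u => exp (- x * exp u - e * softplus u + a * (u + e * softplus u)))).
{ intros t. apply J_eq, Hk. }
assert (Hpos : forall h, Rabs h <= a / 2 -> 0 < a + h).
{ intros h Hh. apply Rabs_le_between in Hh. lra. }
assert (Hlin : forall u, Rabs (u + e * softplus u) <= (1 + Rabs e) * (1 + Rabs u)).
{ intros u. eapply Rle_trans; [apply Rabs_triang|].
  rewrite Rabs_mult, (Rabs_pos_eq (softplus u)) by apply softplus_ge0.
  generalize (Rmult_le_compat_l _ _ _ (Rabs_pos e) (softplus_le u)). lra. }
assert (D0 : forall h, Rabs h <= a / 2 -> Dom (fun u =>
  exp (- x * exp u - e * softplus u + (a + h) * (u + e * softplus u)))).
{ intros h Hh. apply Dom_ext with (kern x (a + h) (e * (a + h - 1))).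
  { intros u; apply Hk. }
  apply Dom_kern; auto. }
assert (Hcs : forall u, continuous (fun u => e * softplus u) u).
{ intros u. apply (continuous_scal_r e softplus), continuous_softplus. }
apply (is_derive_J_exp (fun u => - x * exp u - e * softplus u)
  (fun u => u + e * softplus u) a (a / 2)).
- lra.
- intros u. apply (continuous_minus (fun u => - x * exp u)); [|apply Hcs].
  apply (ex_derive_continuous (fun u => - x * exp u)). auto_derive; exact I.
- intros u. apply (continuous_plus (fun u : R => u) (fun u => e * softplus u));
    [exact (continuous_id u)|apply Hcs].
- exact D0.
- intros h Hh. apply Dom_mul_linear with (1 := Hlin). now apply D0.
- intros h Hh. apply Dom_mul_linear with (1 := Hlin).
  apply Dom_mul_linear with (1 := Hlin). now apply D0.
Qed.

(** Each derivative in [x] shifts [a] by one and changes the sign, so this is Kummer's equation with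
    [b = a + c + 1]. Up to sign, the integrand is the [u]-derivative of [kern x a (c + 1)], whose
    additional factor [1 + exp u] clears the denominator in the derivative of [softplus]. *)
Lemma J_kern_kummer x a c :
  0 < x -> 0 < a ->
  x * J (kern x (a + 1 + 1) c) - (a + c + 1 - x) * J (kern x (a + 1) c)
  - a * J (kern x a c) = 0.
Proof.
intros Hx Ha.
assert (Hs : forall b u, kern x (b + 1) c u = exp u * kern x b c u).
{ intros b u. unfold kern. rewrite <- exp_plus. f_equal. ring. }
set (f := fun u => - x * kern x (a + 1 + 1) c u +
   ((a + c + 1 - x) * kern x (a + 1) c u + a * kern x a c u)).
assert (Hf : is_J f 0).
{ apply (is_J_derive_Dom (kern x a (c + 1))).
  - intros u. evar_last; [apply is_derive_kern|].
    assert (HE : kern x a (c + 1) u = (1 + exp u) * kern x a c u).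
    { unfold kern. rewrite <- exp_softplus, <- exp_plus. f_equal. ring. }
    unfold f. rewrite HE, !Hs. field. generalize (one_plus_exp_pos u); lra.
  - intros u. unfold f.
    apply (continuous_plus (fun u => - x * kern x (a + 1 + 1) c u)).
    + apply (continuous_scal_r (- x) (kern x (a + 1 + 1) c)), continuous_kern.
    + apply (continuous_plus (fun u => (a + c + 1 - x) * kern x (a + 1) c u)).
      * apply (continuous_scal_r (a + c + 1 - x) (kern x (a + 1) c)), continuous_kern.
      * apply (continuous_scal_r a (kern x a c)), continuous_kern.
  - now apply Dom_kern. }
assert (Hf2 : is_J f (- x * J (kern x (a + 1 + 1) c) +
   ((a + c + 1 - x) * J (kern x (a + 1) c) + a * J (kern x a c)))).
{ apply is_J_plus; [|apply is_J_plus]; apply is_J_scal, J_kern_correct; lra. }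
generalize (is_J_inj _ _ _ Hf Hf2). lra.
Qed.

(** * Asymptotics of Laplace's integral *)

Lemma exp_minus_one_bound y : Rabs (exp y - 1) <= Rabs y * exp (Rabs y).
Proof.
assert (H1 : 1 + y <= exp y) by apply exp_ineq1_le.
assert (H2 : 1 - y <= exp (- y)) by (apply (exp_ineq1_le (- y))).
assert (Hi : exp y * exp (- y) = 1)
  by (rewrite <- exp_plus, <- exp_0; f_equal; ring).
assert (H3 := exp_pos y).
assert (H4 : exp y - 1 <= y * exp y) by nra.
destruct (Rle_dec 0 y) as [Hy|Hy].
- rewrite !Rabs_pos_eq by lra. lra.
- assert (1 <= exp (Rabs y))
    by (rewrite <- exp_0; apply exp_monotone, Rabs_pos).
  rewrite Rabs_left1 by nra. rewrite (Rabs_left y) in * by lra. nra.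
Qed.

(** Translation by [- ln x] turns the first term into the integral of
    [exp (- t) t^(a-1) (1 + t/x)^c]. The last factor differs from [1] by at most
    [Rabs c * (t / x) * (1 + t)^(Rabs c)], where [1 <= x] gives [1 + t/x <= 1 + t]; the extra [t]
    turns [a] into [a + 1]. *)
Lemma J_kern_scaling_bound x a c :
  1 <= x -> 0 < a ->
  Rabs (Rpower x a * J (kern x a c) - J (kern 1 a 0))
  <= Rabs c / x * J (kern 1 (a + 1) (Rabs c)).
Proof.
intros Hx Ha.
apply is_J_norm_le with
  (fun u => Rpower x a * kern x a c (u + - ln x) - kern 1 a 0 u)
  (fun u => Rabs c / x * kern 1 (a + 1) (Rabs c) u).
- intros u.
  set (l := softplus (u + - ln x)).
  assert (Hexp : exp (u + - ln x) = exp u / x).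
  { rewrite exp_plus, exp_Ropp, exp_ln by lra. reflexivity. }
  assert (Hl : l = ln (1 + exp u / x)) by (unfold l, softplus; now rewrite Hexp).
  assert (Hu := exp_pos u).
  assert (Hux : 0 < exp u / x) by (apply Rdiv_lt_0_compat; lra).
  assert (Hux1 : exp u / x <= exp u).
  { apply Rmult_le_reg_r with x; [lra|]. unfold Rdiv.
    rewrite Rmult_assoc, Rinv_l by lra. nra. }
  assert (Hl0 : 0 <= l) by apply softplus_ge0.
  assert (Hl1 : l <= exp u / x) by (rewrite Hl; apply ln_1p_le; lra).
  assert (Hl2 : l <= softplus u).
  { rewrite Hl. unfold softplus. apply ln_le; lra. }
  assert (HK : Rpower x a * kern x a c (u + - ln x) = kern 1 a 0 u * exp (c * l)).
  { unfold Rpower, kern. fold l. rewrite Hexp, <- !exp_plus. f_equal. field. lra. }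
  rewrite HK.
  replace (kern 1 a 0 u * exp (c * l) - kern 1 a 0 u) with
    (kern 1 a 0 u * (exp (c * l) - 1)) by ring.
  rewrite Rabs_mult, (Rabs_pos_eq (kern 1 a 0 u)) by (left; apply kern_pos).
  assert (HK1 : kern 1 (a + 1) (Rabs c) u =
     kern 1 a 0 u * (exp u * exp (Rabs c * softplus u))).
  { unfold kern. rewrite <- !exp_plus. f_equal. ring. }
  rewrite HK1.
  replace (Rabs c / x * (kern 1 a 0 u * (exp u * exp (Rabs c * softplus u)))) with
    (kern 1 a 0 u * ((Rabs c * (exp u / x)) * exp (Rabs c * softplus u)))
    by (field; lra).
  apply Rmult_le_compat_l; [left; apply kern_pos|].
  eapply Rle_trans; [apply exp_minus_one_bound|].
  assert (Hc := Rabs_pos c).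
  rewrite Rabs_mult, (Rabs_pos_eq l Hl0).
  apply Rmult_le_compat.
  + now apply Rmult_le_pos.
  + left; apply exp_pos.
  + now apply Rmult_le_compat_l.
  + apply exp_monotone. now apply Rmult_le_compat_l.
- apply is_J_minus; [|apply J_kern_correct; lra].
  apply is_J_scal, is_J_translate. apply J_kern_correct; lra.
- apply is_J_scal, J_kern_correct; lra.
Qed.

Lemma is_lim_of_inv_bound (f : R -> R) (l M : R) :
  (forall x, 1 <= x -> Rabs (f x - l) <= M / x) -> is_lim f p_infty l.
Proof.
intros H. apply is_lim_spec. intros eps.
assert (HM : 0 <= M).
{ specialize (H 1 (Rle_refl 1)). generalize (Rabs_pos (f 1 - l)). lra. }
exists (Rmax 1 (M / eps)). intros x Hx.
assert (H1 := Rmax_l 1 (M / eps)). assert (H2 := Rmax_r 1 (M / eps)).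
assert (He := cond_pos eps).
eapply Rle_lt_trans; [apply H; lra|].
apply Rmult_lt_reg_r with x; [lra|].
unfold Rdiv. rewrite Rmult_assoc, Rinv_l by lra.
assert (H3 : M / eps * eps < x * eps) by (apply Rmult_lt_compat_r; lra).
unfold Rdiv in H3. rewrite Rmult_assoc, Rinv_l in H3 by lra. lra.
Qed.

(** The denominator is [Gamma(a)], so for positive [a] and [x] this is Laplace's integral for
    [U]. *)
Definition laplaceU (a b x : R) : R := J (kern x a (b - a - 1)) / J (kern 1 a 0).

Lemma laplaceU_pos a b x : 0 < a -> 0 < x -> 0 < laplaceU a b x.
Proof. intros Ha Hx. apply Rdiv_lt_0_compat; apply J_kern_pos; lra. Qed.

Lemma is_derive_div_cst (f : R -> R) x l k :
  is_derive f x l -> is_derive (fun x => f x / k) x (l / k).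
Proof.
intros H. unfold Rdiv. apply is_derive_ext with (fun x => / k * f x).
{ intros t. apply Rmult_comm. }
rewrite Rmult_comm. now apply is_derive_scal.
Qed.

Lemma locally_pos x : 0 < x -> locally x (fun y => 0 < y).
Proof. intros Hx. apply (open_gt 0 x Hx). Qed.

(** The explicit derivatives are given on the open half-line only; [Derive (Derive f)] depends on
    [Derive f] near [x], and positivity of [x] provides the neighbourhood. *)
Lemma kummer_derive2 (f f1 f2 : R -> R) (x : R) :
  (forall y, 0 < y -> is_derive f y (f1 y)) ->
  (forall y, 0 < y -> is_derive f1 y (f2 y)) -> 0 < x ->
  ex_derive f x /\ ex_derive (Derive f) x /\
  Derive f x = f1 x /\ Derive (Derive f) x = f2 x.
Proof.
intros H1 H2 Hx.
assert (HD : is_derive (Derive f) x (f2 x)).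
{ apply is_derive_ext_loc with f1; [|now apply H2].
  generalize (locally_pos x Hx). apply filter_imp. intros y Hy.
  symmetry. now apply is_derive_unique, H1. }
split; [|split; [|split]].
- exists (f1 x). now apply H1.
- now exists (f2 x).
- now apply is_derive_unique, H1.
- now apply is_derive_unique.
Qed.

(** The equation is [J_kern_kummer] divided by [Gamma(a)]; the scaling bound gives the asymptotics
    with an error of order [1 / x]. *)
Lemma laplaceU_spec a b : 0 < a -> is_tricomiU a b (laplaceU a b).
Proof.
intros Ha. set (c := b - a - 1).
assert (HG := J_kern_pos 1 a 0 Rlt_0_1 Ha).
assert (H1 : forall y, 0 < y -> is_derive (laplaceU a b) y
   (- J (kern y (a + 1) c) / J (kern 1 a 0))).
{ intros y Hy. apply (is_derive_div_cst (fun y => J (kern y a c))).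
  now apply is_derive_J_kern_x. }
assert (H2 : forall y, 0 < y -> is_derive
   (fun y => - J (kern y (a + 1) c) / J (kern 1 a 0)) y
   (J (kern y (a + 1 + 1) c) / J (kern 1 a 0))).
{ intros y Hy. apply (is_derive_div_cst (fun y => - J (kern y (a + 1) c))).
  rewrite <- (Ropp_involutive (J (kern y (a + 1 + 1) c))).
  apply (is_derive_opp (fun y => J (kern y (a + 1) c))).
  apply is_derive_J_kern_x; lra. }
split.
- intros x Hx.
  destruct (kummer_derive2 _ _ _ x H1 H2 Hx) as [E1 [E2 [-> ->]]].
  split; [exact E1|split; [exact E2|]].
  assert (HK := J_kern_kummer x a c Hx Ha).
  unfold laplaceU. fold c.
  replace (a + c + 1) with b in HK by (unfold c; ring).
  replace (x * (J (kern x (a + 1 + 1) c) / J (kern 1 a 0)) +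
    (b - x) * (- J (kern x (a + 1) c) / J (kern 1 a 0)) -
    a * (J (kern x a c) / J (kern 1 a 0))) with
   ((x * J (kern x (a + 1 + 1) c) - (b - x) * J (kern x (a + 1) c) -
     a * J (kern x a c)) / J (kern 1 a 0)) by (field; lra).
  rewrite HK. unfold Rdiv. ring.
- apply is_lim_of_inv_bound with
    (Rabs c * J (kern 1 (a + 1) (Rabs c)) / J (kern 1 a 0)).
  intros x Hx. unfold laplaceU. fold c.
  replace (Rpower x a * (J (kern x a c) / J (kern 1 a 0)) - 1) with
   ((Rpower x a * J (kern x a c) - J (kern 1 a 0)) / J (kern 1 a 0)) by (field; lra).
  unfold Rdiv at 1. rewrite Rabs_mult, (Rabs_pos_eq (/ _)) by
    (left; now apply Rinv_0_lt_compat).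
  replace (Rabs c * J (kern 1 (a + 1) (Rabs c)) / J (kern 1 a 0) / x) with
   (Rabs c / x * J (kern 1 (a + 1) (Rabs c)) * / J (kern 1 a 0)) by (field; lra).
  apply Rmult_le_compat_r; [left; now apply Rinv_0_lt_compat|].
  now apply J_kern_scaling_bound.
Qed.

(** * Uniqueness of the Tricomi and Bessel functions *)

Lemma MVT_pos (f f' : R -> R) (a b : R) :
  0 < a -> a < b -> (forall x, 0 < x -> is_derive f x (f' x)) ->
  exists c, a <= c <= b /\ f b - f a = f' c * (b - a).
Proof.
intros Ha Hab Hf.
destruct (MVT_gen f a b f') as [c [Hc H]].
- intros x Hx. rewrite Rmin_left in Hx by lra. apply Hf; lra.
- intros x Hx. rewrite Rmin_left in Hx by lra.
  apply derivable_continuous_pt. exists (f' x).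
  apply is_derive_Reals, Hf; lra.
- rewrite Rmin_left, Rmax_right in Hc by lra. now exists c.
Qed.

Lemma constant_of_derive_zero (f : R -> R) (x y : R) :
  (forall x, 0 < x -> is_derive f x 0) -> 0 < x -> 0 < y -> f x = f y.
Proof.
intros Hf.
assert (H : forall x y, 0 < x -> x < y -> f x = f y).
{ intros a b Ha Hab.
  destruct (MVT_pos f (fun _ => 0) a b Ha Hab Hf) as [c [_ Hc]]. lra. }
intros Hx Hy. destruct (Rtotal_order x y) as [Hl|[->|Hg]]; auto.
symmetry; auto.
Qed.

Definition solves2 (P Q f : R -> R) : Prop :=
  forall x, 0 < x -> ex_derive f x /\ ex_derive (Derive f) x /\
    Derive (Derive f) x = P x * Derive f x + Q x * f x.

(* Abel: the Wronskian of [u] and [g] is [c * E], so [(g / u)' = c * E / u^2]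
   stays away from 0 at infinity unless [c = 0]. *)
Lemma solves2_unique (P Q E u g : R -> R) (e0 : R) :
  solves2 P Q u -> solves2 P Q g ->
  (forall x, 0 < x -> 0 < u x) ->
  (forall x, 0 < x -> 0 < E x /\ is_derive E x (P x * E x)) ->
  0 < e0 -> Rbar_locally p_infty (fun x => e0 * u x ^ 2 <= E x) ->
  is_lim (fun x => g x / u x) p_infty 1 ->
  forall x, 0 < x -> g x = u x.
Proof.
intros Hu Hg Hpos HE He0 Hev Hlim.
set (w := fun x => (u x * Derive g x - Derive u x * g x) / E x).
assert (Hw : forall x, 0 < x -> is_derive w x 0).
{ intros x Hx. destruct (Hu x Hx) as [U1 [U2 U3]].
  destruct (Hg x Hx) as [G1 [G2 G3]]. destruct (HE x Hx) as [E1 E2].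
  assert (E3 : ex_derive E x) by (eexists; exact E2).
  unfold w. auto_derive.
  - repeat split; auto. lra.
  - change (fun x => Derive (fun x => g x) x) with (Derive g).
    change (Derive (fun x => Derive g x) x) with (Derive (Derive g) x).
    change (Derive (fun x => Derive u x) x) with (Derive (Derive u) x).
    change (Derive (fun x => g x) x) with (Derive g x).
    change (Derive (fun x => u x) x) with (Derive u x).
    change (Derive (fun x => E x) x) with (Derive E x).
    rewrite (is_derive_unique _ _ _ E2), U3, G3. field. lra. }
set (r := fun x => g x / u x).
assert (Hr : forall x, 0 < x -> is_derive r x (w 1 * (E x / u x ^ 2))).
{ intros x Hx. destruct (Hu x Hx) as [U1 [U2 U3]].
  destruct (Hg x Hx) as [G1 [G2 G3]]. assert (Hp := Hpos x Hx).
  destruct (HE x Hx) as [E1 _].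
  rewrite (constant_of_derive_zero w 1 x Hw Rlt_0_1 Hx).
  unfold r, w. auto_derive.
  - repeat split; auto. lra.
  - change (Derive (fun x => g x) x) with (Derive g x).
    change (Derive (fun x => u x) x) with (Derive u x).
    field. lra. }
apply is_lim_spec in Hlim.
assert (Hc : w 1 = 0).
{ destruct (Req_dec (w 1) 0) as [|Hn]; [assumption|exfalso].
  (* With this tolerance [r] eventually varies by less than half of [Rabs (w 1) * e0], while over a
     step of length 1 the mean value theorem forces a variation of at least the whole. *)
  assert (Hk : 0 < Rabs (w 1) * e0 / 4).
  { apply Rdiv_lt_0_compat; [|lra]. apply Rmult_lt_0_compat; [|exact He0].
    now apply Rabs_pos_lt. }
  destruct (Hlim (mkposreal _ Hk)) as [M1 H1]. destruct Hev as [M2 H2].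
  set (y := Rmax 1 (Rmax M1 M2) + 1).
  assert (Y1 := Rmax_l 1 (Rmax M1 M2)). assert (Y2 := Rmax_r 1 (Rmax M1 M2)).
  assert (Y3 := Rmax_l M1 M2). assert (Y4 := Rmax_r M1 M2).
  assert (Hyr := H1 y ltac:(unfold y; lra)).
  assert (Hyr2 := H1 (y + 1) ltac:(unfold y; lra)). simpl in Hyr, Hyr2.
  destruct (MVT_pos r _ y (y + 1) ltac:(unfold y; lra) ltac:(lra) Hr)
    as [c [Hcy Hc]].
  assert (Hcp : 0 < c) by (unfold y in Hcy; lra).
  assert (HEc := H2 c ltac:(unfold y in Hcy; lra)).
  assert (Hup := Hpos c Hcp).
  assert (Hq : e0 <= E c / u c ^ 2).
  { apply Rmult_le_reg_r with (u c ^ 2); [now apply pow_lt|].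
    unfold Rdiv. rewrite Rmult_assoc, Rinv_l by (apply pow_nonzero; lra). lra. }
  assert (Habs : Rabs (w 1) * e0 <= Rabs (r (y + 1) - r y)).
  { rewrite Hc. replace (y + 1 - y) with 1 by ring. rewrite Rmult_1_r, Rabs_mult.
    apply Rmult_le_compat_l; [apply Rabs_pos|].
    eapply Rle_trans; [exact Hq|apply Rle_abs]. }
  assert (Rabs (r (y + 1) - r y) <= Rabs (r (y + 1) - 1) + Rabs (r y - 1)).
  { replace (r (y + 1) - r y) with ((r (y + 1) - 1) - (r y - 1)) by ring.
    unfold Rminus at 1. eapply Rle_trans; [apply Rabs_triang|].
    rewrite Rabs_Ropp. lra. }
  unfold r in *. lra. }
assert (Hr0 : forall x, 0 < x -> is_derive r x 0).
{ intros x Hx. generalize (Hr x Hx). now rewrite Hc, Rmult_0_l. }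
intros x Hx.
assert (Hrx : r x = 1).
{ destruct (Req_dec (r x) 1) as [|Hn]; [assumption|exfalso].
  assert (Hk : 0 < Rabs (r x - 1)) by (apply Rabs_pos_lt; lra).
  destruct (Hlim (mkposreal _ Hk)) as [M HM].
  assert (Y1 := Rmax_l 1 M). assert (Y2 := Rmax_r 1 M).
  specialize (HM (Rmax 1 M + 1) ltac:(lra)). simpl in HM.
  fold (r (Rmax 1 M + 1)) in HM.
  rewrite (constant_of_derive_zero r (Rmax 1 M + 1) x Hr0) in HM; lra. }
assert (Hp := Hpos x Hx). unfold r in Hrx.
replace (g x) with (g x / u x * u x) by (field; lra). rewrite Hrx. ring.
Qed.

Lemma eventually_lt_2 (f : R -> R) :
  is_lim f p_infty 1 -> Rbar_locally p_infty (fun x => f x < 2).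
Proof.
intros H. apply is_lim_spec in H.
generalize (H (mkposreal 1 Rlt_0_1)). simpl. intros [M HM]. exists M.
intros x Hx. specialize (HM x Hx). apply Rabs_lt_between in HM. lra.
Qed.

Lemma is_lim_ratio_one (w f g : R -> R) :
  (forall x, 0 < x -> w x <> 0) -> (forall x, 0 < x -> f x <> 0) ->
  is_lim (fun x => w x * f x) p_infty 1 -> is_lim (fun x => w x * g x) p_infty 1 ->
  is_lim (fun x => g x / f x) p_infty 1.
Proof.
intros Hw Hf H1 H2.
apply is_lim_ext_loc with (fun x => (w x * g x) / (w x * f x)).
- exists 0. intros x Hx. field. split; auto.
- replace 1 with (1 / 1) by field.
  apply (is_lim_div _ _ p_infty 1 1 H2 H1); simpl; trivial.
  intros Heq. injection Heq. lra.
Qed.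

Lemma locally_infty_ge (M : R) : Rbar_locally p_infty (fun x => M < x).
Proof. now exists M. Qed.

(** The candidate [u] plays two parts: its existence makes [epsilon] return a genuine solution, and
    its positivity makes it the denominator of the Wronskian argument. The case [b = 2 * a] is that
    of [kappa = 0]. *)
Lemma tricomiU_eq (a : R) (u : R -> R) :
  is_tricomiU a (2 * a) u -> (forall x, 0 < x -> 0 < u x) ->
  forall x, 0 < x -> tricomiU a (2 * a) x = u x.
Proof.
intros Hu Hpos.
assert (Hg : is_tricomiU a (2 * a) (tricomiU a (2 * a)))
  by (unfold tricomiU; apply epsilon_spec; now exists u).
set (g := tricomiU a (2 * a)) in *. clearbody g.
assert (Hs : forall f, is_tricomiU a (2 * a) f ->
  solves2 (fun x => (x - 2 * a) / x) (fun x => a / x) f).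
{ intros f [Hf _] x Hx. destruct (Hf x Hx) as [H1 [H2 H3]].
  split; [exact H1|split; [exact H2|]].
  apply Rmult_eq_reg_l with x; [|lra].
  replace (x * ((x - 2 * a) / x * Derive f x + a / x * f x)) with
    ((x - 2 * a) * Derive f x + a * f x) by (field; lra). lra. }
(* Eventually [x^a * u x < 2], hence [u x ^ 2 <= 4 * x^(-2a) <= 4 * E x], which is where [/ 4] comes
   from. *)
apply solves2_unique with (fun x => (x - 2 * a) / x) (fun x => a / x)
  (fun x => exp x * Rpower x (- (2 * a))) (/ 4); auto.
- intros x Hx. split.
  + apply Rmult_lt_0_compat; apply exp_pos.
  + unfold Rpower. auto_derive; [exact Hx|]. field. lra.
- lra.
- generalize (filter_and _ _ (locally_infty_ge 0) (eventually_lt_2 _ (proj2 Hu))).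
  apply filter_imp. intros x [Hx H]. assert (Hp := Hpos x Hx).
  set (p := Rpower x a) in *.
  assert (Hpp : 0 < p) by apply exp_pos.
  replace (Rpower x (- (2 * a))) with (/ (p * p)).
  2:{ unfold p. rewrite Rpower_Ropp. f_equal. rewrite <- Rpower_plus. f_equal. ring. }
  assert (1 <= exp x) by (rewrite <- exp_0; apply exp_monotone; lra).
  apply Rmult_le_reg_r with (p * p); [nra|].
  rewrite (Rmult_assoc (exp x)), Rinv_l by nra.
  assert (0 < p * u x) by nra.
  replace (/ 4 * u x ^ 2 * (p * p)) with ((p * u x) * (p * u x) / 4) by field.
  nra.
- apply is_lim_ratio_one with (fun x => Rpower x a).
  + intros x _. apply Rgt_not_eq, exp_pos.
  + intros x Hx. apply Rgt_not_eq, Hpos, Hx.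
  + apply Hu.
  + apply Hg.
Qed.

Lemma besselK_eq (nu : R) (u : R -> R) :
  is_besselK nu u -> (forall x, 0 < x -> 0 < u x) ->
  forall x, 0 < x -> besselK nu x = u x.
Proof.
intros Hu Hpos.
assert (Hg : is_besselK nu (besselK nu)) by (unfold besselK; apply epsilon_spec; now exists u).
set (g := besselK nu) in *. clearbody g.
assert (Hs : forall f, is_besselK nu f ->
  solves2 (fun x => - / x) (fun x => 1 + nu ^ 2 / x ^ 2) f).
{ intros f [Hf _] x Hx. destruct (Hf x Hx) as [H1 [H2 H3]].
  split; [exact H1|split; [exact H2|]].
  apply Rmult_eq_reg_l with (x ^ 2); [|apply pow_nonzero; lra].
  replace (x ^ 2 * (- / x * Derive f x + (1 + nu ^ 2 / x ^ 2) * f x)) with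
    (- x * Derive f x + (x ^ 2 + nu ^ 2) * f x) by (field; lra). lra. }
assert (HPI := PI_RGT_0).
assert (Hsq : forall x, 0 < x -> 0 < 2 * x / PI)
  by (intros x Hx; apply Rdiv_lt_0_compat; lra).
(* Here the Wronskian decays, but only like [/ x]. Eventually [sqrt (2 * x / PI) * u x < 2], so
   [u x ^ 2 <= 2 * PI / x], which fixes the constant. *)
apply solves2_unique with (fun x => - / x) (fun x => 1 + nu ^ 2 / x ^ 2)
  (fun x => / x) (/ (2 * PI)); auto.
- intros x Hx. split.
  + now apply Rinv_0_lt_compat.
  + auto_derive; [lra|]. field. lra.
- apply Rinv_0_lt_compat. lra.
- generalize (filter_and _ _ (locally_infty_ge 0) (eventually_lt_2 _ (proj2 Hu))).
  apply filter_imp. intros x [Hx H]. assert (Hp := Hpos x Hx).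
  assert (Hq := sqrt_lt_R0 _ (Hsq x Hx)).
  assert (Hqq := sqrt_sqrt _ (Rlt_le _ _ (Hsq x Hx))).
  set (q := sqrt (2 * x / PI)) in *.
  assert (1 <= exp x) by (rewrite <- exp_0; apply exp_monotone; lra).
  assert (H1 : 0 < q * u x) by nra.
  assert (H2 : q * u x < 2) by nra.
  assert (H3 : (q * q) * u x ^ 2 <= 4) by nra.
  rewrite Hqq in H3.
  apply Rmult_le_reg_r with (4 * x); [lra|].
  replace (/ (2 * PI) * u x ^ 2 * (4 * x)) with (2 * x / PI * u x ^ 2)
    by (field; lra).
  replace (/ x * (4 * x)) with 4 by (field; lra). exact H3.
- apply is_lim_ratio_one with (fun x => sqrt (2 * x / PI) * exp x).
  + intros x Hx. apply Rgt_not_eq, Rmult_lt_0_compat; [|apply exp_pos].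
    apply sqrt_lt_R0, Hsq, Hx.
  + intros x Hx. apply Rgt_not_eq, Hpos, Hx.
  + apply Hu.
  + apply Hg.
Qed.

(** * The functions W and K *)

Lemma Rpower_pos x y : 0 < Rpower x y.
Proof. apply exp_pos. Qed.

Lemma is_derive_Rpower_l p x :
  0 < x -> is_derive (fun x => Rpower x p) x (p / x * Rpower x p).
Proof. intros Hx. unfold Rpower. auto_derive; [exact Hx|]. field. lra. Qed.

(** The normalisation is preserved because [x^(1-a) x^(2a-1) = x^a]. This supplies solutions for
    parameters [1 - a <= 0], where Laplace's integral diverges. *)
Lemma kummer_transformation (a : R) (u : R -> R) :
  is_tricomiU a (2 * a) u ->
  is_tricomiU (1 - a) (2 * (1 - a)) (fun x => Rpower x (2 * a - 1) * u x).
Proof.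
intros [Hode Hlim]. set (p := 2 * a - 1).
set (u1 := Derive u). set (u2 := Derive u1).
assert (Hu : forall y, 0 < y -> is_derive u y (u1 y)).
{ intros y Hy. apply Derive_correct. apply (Hode y Hy). }
assert (Hu1 : forall y, 0 < y -> is_derive u1 y (u2 y)).
{ intros y Hy. apply Derive_correct. apply (Hode y Hy). }
set (f1 := fun x => Rpower x p * (p / x * u x + u1 x)).
set (f2 := fun x => Rpower x p *
  (p * (p - 1) / x ^ 2 * u x + 2 * p / x * u1 x + u2 x)).
assert (H1 : forall y, 0 < y -> is_derive (fun x : R => Rpower x p * u x) y (f1 y)).
{ intros y Hy. evar_last.
  - apply (is_derive_mult (fun x => Rpower x p) u);
      [now apply is_derive_Rpower_l|now apply Hu|intros; apply Rmult_comm].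
  - unfold f1, plus, mult; simpl. ring. }
assert (H2 : forall y, 0 < y -> is_derive f1 y (f2 y)).
{ intros y Hy. evar_last.
  - apply (is_derive_mult (fun x => Rpower x p) (fun x => p / x * u x + u1 x)).
    + now apply is_derive_Rpower_l.
    + apply (is_derive_plus (fun x => p / x * u x) u1); [|now apply Hu1].
      apply (is_derive_mult (fun x => p / x) u (y : R) (- p / y ^ 2));
        [|now apply Hu|intros; apply Rmult_comm].
      auto_derive; [lra|field; lra].
    + intros; apply Rmult_comm.
  - unfold f2, plus, mult; simpl. field. lra. }
split.
- intros x Hx.
  destruct (kummer_derive2 _ _ _ x H1 H2 Hx) as [E1 [E2 [-> ->]]].
  split; [exact E1|split; [exact E2|]].
  destruct (Hode x Hx) as [_ [_ Ho]]. fold u1 in Ho. fold u2 in Ho.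
  unfold f1, f2.
  replace (x * (Rpower x p * (p * (p - 1) / x ^ 2 * u x + 2 * p / x * u1 x + u2 x)) +
    (2 * (1 - a) - x) * (Rpower x p * (p / x * u x + u1 x)) -
    (1 - a) * (Rpower x p * u x)) with
    (Rpower x p * (x * u2 x + (2 * a - x) * u1 x - a * u x)).
  + rewrite Ho. ring.
  + unfold p. field. lra.
- apply is_lim_ext with (fun x => Rpower x a * u x); [|exact Hlim].
  intros x. rewrite <- Rmult_assoc, <- Rpower_plus. do 2 f_equal. unfold p. ring.
Qed.

Lemma whittakerW_laplace (mu x : R) : - (1 / 2) < mu -> 0 < x ->
  whittakerW 0 mu x = exp (- x / 2) * Rpower x (mu + 1 / 2)
    * laplaceU (mu + 1 / 2) (2 * (mu + 1 / 2)) x.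
Proof.
intros Hmu Hx. unfold whittakerW. f_equal.
replace (1 / 2 + mu - 0) with (mu + 1 / 2) by ring.
replace (1 + 2 * mu) with (2 * (mu + 1 / 2)) by field.
apply tricomiU_eq; [apply laplaceU_spec; lra| |exact Hx].
intros y Hy. apply laplaceU_pos; lra.
Qed.

Lemma whittakerW_even (mu x : R) : - (1 / 2) < mu -> 0 < x ->
  whittakerW 0 (- mu) x = whittakerW 0 mu x.
Proof.
intros Hmu Hx. rewrite (whittakerW_laplace mu) by assumption.
set (a := mu + 1 / 2). unfold whittakerW.
replace (1 / 2 + - mu - 0) with (1 - a) by (unfold a; field).
replace (1 + 2 * - mu) with (2 * (1 - a)) by (unfold a; field).
assert (Ha : 0 < a) by (unfold a; lra).
rewrite (tricomiU_eq _ _ (kummer_transformation a _ (laplaceU_spec a (2 * a) Ha))).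
(* The power [x^(2a-1)] of the transformation turns the prefactor [x^(1-a)] into [x^a]. *)
- rewrite <- !Rmult_assoc. f_equal.
  rewrite Rmult_assoc, <- Rpower_plus. do 2 f_equal. unfold a. field.
- intros y Hy. apply Rmult_lt_0_compat; [apply Rpower_pos|now apply laplaceU_pos].
- exact Hx.
Qed.

(** The prefactor [m] has logarithmic derivative [-1 + nu / z], and Bessel's operator applied to the
    product is [2 z m(z)] times Kummer's operator on [u], evaluated at [2 z]. *)
Lemma besselK_of_tricomiU (nu : R) (u : R -> R) :
  is_tricomiU (nu + 1 / 2) (2 * (nu + 1 / 2)) u ->
  is_besselK nu (fun z => sqrt PI * exp (- z) * Rpower (2 * z) nu * u (2 * z)).
Proof.
intros [Hode Hlim].
set (u1 := Derive u). set (u2 := Derive u1).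
assert (Hu : forall y, 0 < y -> is_derive (fun z => u (2 * z)) y (2 * u1 (2 * y))).
{ intros y Hy. apply (is_derive_comp u (fun z => 2 * z)).
  - apply Derive_correct. apply (Hode (2 * y)); lra.
  - auto_derive; [exact I|ring]. }
assert (Hu1 : forall y, 0 < y -> is_derive (fun z => u1 (2 * z)) y (2 * u2 (2 * y))).
{ intros y Hy. apply (is_derive_comp u1 (fun z => 2 * z)).
  - apply Derive_correct. apply (Hode (2 * y)); lra.
  - auto_derive; [exact I|ring]. }
set (m := fun z => sqrt PI * exp (- z) * Rpower (2 * z) nu).
assert (Hm : forall y, 0 < y -> is_derive m y ((-1 + nu / y) * m y)).
{ intros y Hy. unfold m, Rpower. auto_derive; [lra|]. field. lra. }
set (f1 := fun z => m z * ((-1 + nu / z) * u (2 * z) + 2 * u1 (2 * z))).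
set (f2 := fun z => m z * (((-1 + nu / z) ^ 2 - nu / z ^ 2) * u (2 * z) +
  4 * (-1 + nu / z) * u1 (2 * z) + 4 * u2 (2 * z))).
assert (H1 : forall y, 0 < y -> is_derive (fun z : R => m z * u (2 * z)) y (f1 y)).
{ intros y Hy. evar_last.
  - apply (is_derive_mult m (fun z => u (2 * z)));
      [now apply Hm|now apply Hu|intros; apply Rmult_comm].
  - unfold f1, plus, mult; simpl. ring. }
assert (H2 : forall y, 0 < y -> is_derive f1 y (f2 y)).
{ intros y Hy. evar_last.
  - apply (is_derive_mult m (fun z => (-1 + nu / z) * u (2 * z) + 2 * u1 (2 * z))).
    + now apply Hm.
    + apply (is_derive_plus (fun z => (-1 + nu / z) * u (2 * z))
        (fun z => 2 * u1 (2 * z))).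
      * apply (is_derive_mult (fun z => -1 + nu / z) (fun z => u (2 * z)) (y : R)
          (- nu / y ^ 2)); [|now apply Hu|intros; apply Rmult_comm].
        auto_derive; [lra|field; lra].
      * apply (is_derive_scal (fun z => u1 (2 * z)) y 2). now apply Hu1.
    + intros; apply Rmult_comm.
  - unfold f2, plus, mult; simpl. field. lra. }
split.
- intros x Hx.
  destruct (kummer_derive2 _ _ _ x H1 H2 Hx) as [E1 [E2 [D1 D2]]].
  fold (m x).
  change (fun z => sqrt PI * exp (- z) * Rpower (2 * z) nu * u (2 * z))
    with (fun z => m z * u (2 * z)).
  rewrite D1, D2.
  split; [exact E1|split; [exact E2|]].
  destruct (Hode (2 * x) ltac:(lra)) as [_ [_ Ho]]. fold u1 in Ho. fold u2 in Ho.
  unfold f1, f2.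
  transitivity (2 * x * m x * (2 * x * u2 (2 * x) +
   (2 * (nu + 1 / 2) - 2 * x) * u1 (2 * x) - (nu + 1 / 2) * u (2 * x))).
  + field. lra.
  + rewrite Ho. ring.
- assert (Hl2 : is_lim (fun z => Rpower (2 * z) (nu + 1 / 2) * u (2 * z)) p_infty 1).
  { intros P HP. destruct (Hlim P HP) as [M HM]. exists (M / 2).
    intros z Hz. apply HM. lra. }
  apply is_lim_ext_loc with (2 := Hl2). exists 0. intros z Hz.
  assert (HPI := PI_RGT_0).
  assert (Hsp : 0 < sqrt PI) by now apply sqrt_lt_R0.
  rewrite sqrt_div_alt by lra.
  rewrite <- (Rpower_sqrt (2 * z)) by lra.
  rewrite Rpower_plus. replace (1 / 2) with (/ 2) by field.
  assert (He : exp (- z) = / exp z) by apply exp_Ropp.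
  rewrite He. assert (Hez := exp_pos z). field. lra.
Qed.

(** By this the coefficient of [E_1(x) - H_n] in the theorem is [W] itself, so both terms of the
    formula become sums over the same coefficients. *)
Lemma besselK_whittakerW (nu x : R) : - (1 / 2) < nu -> 0 < x ->
  sqrt (x / PI) * besselK nu (x / 2) = whittakerW 0 nu x.
Proof.
intros Hnu Hx. rewrite whittakerW_laplace by assumption.
assert (Ha : 0 < nu + 1 / 2) by lra.
rewrite (besselK_eq _ _ (besselK_of_tricomiU nu _
  (laplaceU_spec (nu + 1 / 2) (2 * (nu + 1 / 2)) Ha))); [| |lra].
- assert (HPI := PI_RGT_0).
  assert (Hsp : 0 < sqrt PI) by now apply sqrt_lt_R0.
  rewrite sqrt_div_alt by lra.
  rewrite <- (Rpower_sqrt x) by lra.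
  replace (2 * (x / 2)) with x by field. replace (- (x / 2)) with (- x / 2) by field.
  rewrite (Rpower_plus nu). replace (1 / 2) with (/ 2) by field.
  field. lra.
- intros z Hz. apply Rmult_lt_0_compat; [|apply laplaceU_pos; lra].
  apply Rmult_lt_0_compat; [|apply Rpower_pos].
  apply Rmult_lt_0_compat; [|apply exp_pos]. apply sqrt_lt_R0, PI_RGT_0.
Qed.

(** * Moments at integer exponents *)

Lemma kern_succ x a c u : kern x (a + 1) c u = exp u * kern x a c u.
Proof. unfold kern. rewrite <- exp_plus. f_equal. ring. Qed.

Lemma kern_split x a c u : kern x a c u = kern x a (c - 1) u + kern x (a + 1) (c - 1) u.
Proof.
rewrite kern_succ. unfold kern.
replace (- x * exp u + a * u + c * softplus u) with
  (softplus u + (- x * exp u + a * u + (c - 1) * softplus u)) by ring.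
rewrite (exp_plus (softplus u)), exp_softplus. ring.
Qed.

Lemma is_derive_kern0 x a u :
  is_derive (kern x a 0) u (- x * kern x (a + 1) 0 u + a * kern x a 0 u).
Proof. evar_last; [apply is_derive_kern|]. rewrite kern_succ. ring. Qed.

Lemma J_kern0_succ x a : 0 < x -> 0 < a ->
  x * J (kern x (a + 1) 0) = a * J (kern x a 0).
Proof.
intros Hx Ha.
assert (H : is_J (fun u => - x * kern x (a + 1) 0 u + a * kern x a 0 u)
  (- x * J (kern x (a + 1) 0) + a * J (kern x a 0))).
{ apply is_J_plus; apply is_J_scal, J_kern_correct; lra. }
assert (H0 : is_J (fun u => - x * kern x (a + 1) 0 u + a * kern x a 0 u) 0).
{ apply (is_J_derive_Dom (kern x a 0)).
  - apply is_derive_kern0.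
  - intros u. apply (continuous_plus (fun u => - x * kern x (a + 1) 0 u)).
    + apply (continuous_scal_r (- x) (kern x (a + 1) 0)), continuous_kern.
    + apply (continuous_scal_r a (kern x a 0)), continuous_kern.
  - now apply Dom_kern. }
generalize (is_J_inj _ _ _ H H0). lra.
Qed.

(** The primitive [kern x 0 0] tends to [1] at [m_infty], not to [0], so [is_J_derive_Dom] is
    replaced by the fundamental theorem with both boundary values. This starts the induction for the
    factorials. *)
Lemma J_kern_1 x : 0 < x -> J (kern x 1 0) = / x.
Proof.
intros Hx.
assert (Hk : forall u, kern x 0 0 u = exp (- x * exp u))
  by (intros u; unfold kern; f_equal; ring).
assert (H : is_J (fun u => - x * kern x 1 0 u) (0 - 1)).
{ apply (is_RInt_gen_FTC minf pinf (kern x 0 0)).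
  - apply filter_forall. intros ab u _. split.
    + evar_last; [apply is_derive_kern0|]. rewrite Rplus_0_l. simpl. ring.
    + apply (continuous_scal_r (- x) (kern x 1 0)), continuous_kern.
  - apply filterlim_ext with (fun u => exp (- x * exp u)); [intros; now rewrite Hk|].
    apply (filterlim_comp _ _ _ exp (fun y => exp (- x * y)) minf (locally 0)).
    + exact is_lim_exp_m.
    + replace 1 with (exp (- x * 0)) by (rewrite Rmult_0_r; apply exp_0).
      apply (ex_derive_continuous (fun y => exp (- x * y)) 0). auto_derive; exact I.
  - apply filterlim_ext with (fun u => 1 * exp (- x * exp u)).
    { intros; now rewrite Hk, Rmult_1_l. }
    apply (filterlim_comp _ _ _ exp (fun y => 1 * exp (- x * y)) pinf pinf).
    + exact is_lim_exp_p.
    + now apply filterlim_exp_decay. }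
assert (H2 := is_J_inj _ _ _ H (is_J_scal _ (- x) _ (J_kern_correct x 1 0 Hx Rlt_0_1))).
apply Rmult_eq_reg_l with x; [|lra]. rewrite Rinv_r; lra.
Qed.

Lemma J_kern_fact x m : 0 < x -> J (kern x (INR (S m)) 0) = INR (fact m) / x ^ S m.
Proof.
intros Hx. induction m as [|m IH].
- simpl INR. rewrite J_kern_1 by exact Hx. simpl. field. lra.
- rewrite S_INR.
  assert (Hm : 0 < INR (S m)) by (apply lt_0_INR; lia).
  apply Rmult_eq_reg_l with x; [|lra].
  rewrite J_kern0_succ, IH by assumption.
  rewrite fact_simpl, mult_INR. simpl pow. field.
  split; [apply pow_nonzero; lra|lra].
Qed.

Lemma harmonic_0 : harmonic 0 = 0.
Proof. unfold harmonic. now rewrite sum_n_m_zero by lia. Qed.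

Lemma harmonic_S k : harmonic (S k) = harmonic k + / INR (S k).
Proof. unfold harmonic. rewrite sum_n_Sm by lia. reflexivity. Qed.

Lemma INR_fact_pos m : 0 < INR (fact m).
Proof. apply lt_0_INR, lt_O_fact. Qed.

(** Integration by parts against [exp (- x t) t^a], the boundary terms vanishing by decay; [h] is
    the identity for moments of [ln t] and [softplus] for those of [ln (1+t)]. *)
Lemma is_J_mul_kern_step (h h' : R -> R) (x a : R) :
  (forall u, is_derive h u (h' u)) -> (forall u, continuous h' u) ->
  Dom (fun u => h u * kern x a 0 u) ->
  is_J (fun u => h' u * kern x a 0 u +
     (- x * (h u * kern x (a + 1) 0 u) + a * (h u * kern x a 0 u))) 0.
Proof.
intros Hh Hc HD.
assert (Hch : forall u, continuous h u).
{ intros u. eapply is_derive_continuous, Hh. }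
apply (is_J_derive_Dom (fun u => h u * kern x a 0 u)).
- intros u. evar_last.
  + apply (is_derive_mult h (kern x a 0)); [apply Hh|apply is_derive_kern0|].
    intros; apply Rmult_comm.
  + unfold plus, mult; simpl. ring.
- intros u.
  apply (continuous_plus (fun u => h' u * kern x a 0 u)).
  { apply (continuous_mult h' (kern x a 0)); [apply Hc|apply continuous_kern]. }
  apply (continuous_plus (fun u => - x * (h u * kern x (a + 1) 0 u))).
  + apply (continuous_scal_r (- x) (fun u => h u * kern x (a + 1) 0 u)).
    apply (continuous_mult h (kern x (a + 1) 0)); [apply Hch|apply continuous_kern].
  + apply (continuous_scal_r a (fun u => h u * kern x a 0 u)).
    apply (continuous_mult h (kern x a 0)); [apply Hch|apply continuous_kern].
- exact HD.
Qed.

Lemma Dom_id_kern x a c : 0 < x -> 0 < a -> Dom (fun u => u * kern x a c u).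
Proof.
intros Hx Ha. apply (Dom_mul_linear (fun u => u) 1); [|now apply Dom_kern].
intros u. lra.
Qed.

Lemma Dom_softplus_kern x a c :
  0 < x -> 0 <= a -> Dom (fun u => softplus u * kern x a c u).
Proof.
intros Hx Ha. apply Dom_le with (kern x (a + 1) c); [|apply Dom_kern; lra].
intros u. rewrite kern_succ, !Rabs_mult.
apply Rmult_le_compat_r; [apply Rabs_pos|].
rewrite !Rabs_pos_eq; [apply softplus_le_exp|left; apply exp_pos|apply softplus_ge0].
Qed.

Lemma continuous_id_kern x a c u : continuous (fun u => u * kern x a c u) u.
Proof.
apply (continuous_mult (fun u : R => u) (kern x a c));
  [exact (continuous_id u)|apply continuous_kern].
Qed.

Lemma continuous_softplus_kern x a c u :
  continuous (fun u => softplus u * kern x a c u) u.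
Proof.
apply (continuous_mult softplus (kern x a c));
  [apply continuous_softplus|apply continuous_kern].
Qed.

(** The integral of [exp (- x t) t^(a-1) ln t]; [log_moment 1 1] is minus Euler's constant. *)
Definition log_moment (x a : R) : R := J (fun u => u * kern x a 0 u).
Definition softplus_moment (x a : R) : R := J (fun u => softplus u * kern x a 0 u).

Lemma log_moment_correct x a : 0 < x -> 0 < a ->
  is_J (fun u => u * kern x a 0 u) (log_moment x a).
Proof.
intros Hx Ha. apply J_correct;
  [intros; apply continuous_id_kern|now apply Dom_id_kern].
Qed.

Lemma softplus_moment_correct x a : 0 < x -> 0 < a ->
  is_J (fun u => softplus u * kern x a 0 u) (softplus_moment x a).
Proof.
intros Hx Ha. apply J_correct;
  [intros; apply continuous_softplus_kern|apply Dom_softplus_kern; lra].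
Qed.

Lemma log_moment_succ x a : 0 < x -> 0 < a ->
  x * log_moment x (a + 1) = a * log_moment x a + J (kern x a 0).
Proof.
intros Hx Ha.
assert (H := is_J_mul_kern_step (fun u => u) (fun _ => 1) x a
  (fun u => is_derive_id u) (fun u => continuous_const 1 u) (Dom_id_kern x a 0 Hx Ha)).
assert (H2 : is_J (fun u => 1 * kern x a 0 u +
     (- x * (u * kern x (a + 1) 0 u) + a * (u * kern x a 0 u)))
  (1 * J (kern x a 0) + (- x * log_moment x (a + 1) + a * log_moment x a))).
{ apply is_J_plus; [|apply is_J_plus]; apply is_J_scal.
  - now apply J_kern_correct.
  - apply log_moment_correct; lra.
  - now apply log_moment_correct. }
generalize (is_J_inj _ _ _ H H2). lra.
Qed.

(** Once [m! / x^(m+1)] is factored out, the inhomogeneous term of the recurrence is worth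
    [1 / (m+1)], and these terms add up to the harmonic number. *)
Lemma log_moment_fact x m : 0 < x ->
  log_moment x (INR (S m)) =
  INR (fact m) / x ^ S m * (harmonic m + x * log_moment x 1).
Proof.
intros Hx. induction m as [|m IH].
- rewrite harmonic_0. simpl. field. lra.
- assert (Hm : 0 < INR (S m)) by (apply lt_0_INR; lia).
  rewrite (S_INR (S m)).
  apply Rmult_eq_reg_l with x; [|lra].
  rewrite log_moment_succ, IH, J_kern_fact by assumption.
  rewrite harmonic_S, fact_simpl, mult_INR. simpl pow. field.
  split; [|split]; [| apply pow_nonzero|]; lra.
Qed.

Lemma log_moment_1 x : 0 < x -> x * log_moment x 1 = log_moment 1 1 - ln x.
Proof.
intros Hx.
assert (H1 := is_J_translate _ (- ln x) _ (log_moment_correct x 1 Hx Rlt_0_1)).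
assert (Hk : forall u, kern x 1 0 (u + - ln x) = kern 1 1 0 u / x).
{ intros u. unfold kern. rewrite (exp_plus u (- ln x)), (exp_Ropp (ln x)), exp_ln by exact Hx.
  replace (- x * (exp u * / x) + 1 * (u + - ln x) + 0 * softplus (u + - ln x)) with
   ((-1 * exp u + 1 * u + 0 * softplus u) + - ln x) by (field; lra).
  rewrite (exp_plus _ (- ln x)), exp_Ropp, exp_ln by exact Hx. reflexivity. }
assert (H2 : is_J (fun u => / x * (u * kern 1 1 0 u) - (ln x / x) * kern 1 1 0 u)
  (/ x * log_moment 1 1 - ln x / x * J (kern 1 1 0))).
{ apply is_J_minus; apply is_J_scal;
   [apply log_moment_correct|apply J_kern_correct]; lra. }
rewrite J_kern_1 in H2 by lra.
assert (H3 : log_moment x 1 = / x * log_moment 1 1 - ln x / x * / 1).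
{ apply (is_J_inj _ _ _ H1). apply is_J_ext with (2 := H2).
  intros u. rewrite Hk. field. lra. }
rewrite H3. field. lra.
Qed.

(** The derivative [exp u / (1 + exp u)] of [softplus] turns the kernel into one with [c = -1], that
    is [exp (- x t) t^a / (1 + t)] in the variable [t]. *)
Lemma is_J_softplus_step x a : 0 < x -> 0 <= a ->
  is_J (fun u => kern x (a + 1) (-1) u +
     (- x * (softplus u * kern x (a + 1) 0 u) + a * (softplus u * kern x a 0 u))) 0.
Proof.
intros Hx Ha.
apply is_J_ext with (2 := is_J_mul_kern_step softplus (fun u => exp u / (1 + exp u)) x a
  is_derive_softplus
  (fun u => ltac:(apply (ex_derive_continuous (fun u => exp u / (1 + exp u)));
     auto_derive; generalize (one_plus_exp_pos u); lra))
  (Dom_softplus_kern x a 0 Hx Ha)).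
intros u. f_equal. rewrite kern_succ, (kern_split x a 0), kern_succ.
replace (0 - 1) with (-1) by ring. field. generalize (one_plus_exp_pos u); lra.
Qed.

Lemma softplus_moment_succ x a : 0 < x -> 0 < a ->
  x * softplus_moment x (a + 1) = a * softplus_moment x a + J (kern x (a + 1) (-1)).
Proof.
intros Hx Ha.
assert (H := is_J_softplus_step x a Hx (Rlt_le _ _ Ha)).
assert (H2 : is_J (fun u => kern x (a + 1) (-1) u +
     (- x * (softplus u * kern x (a + 1) 0 u) + a * (softplus u * kern x a 0 u)))
  (J (kern x (a + 1) (-1)) +
     (- x * softplus_moment x (a + 1) + a * softplus_moment x a))).
{ apply is_J_plus; [|apply is_J_plus; apply is_J_scal].
  - apply J_kern_correct; lra.
  - apply softplus_moment_correct; lra.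
  - now apply softplus_moment_correct. }
generalize (is_J_inj _ _ _ H H2). lra.
Qed.

Lemma softplus_moment_1 x : 0 < x -> x * softplus_moment x 1 = J (kern x 1 (-1)).
Proof.
intros Hx.
assert (H := is_J_softplus_step x 0 Hx (Rle_refl 0)). rewrite Rplus_0_l in H.
assert (H2 : is_J (fun u => kern x 1 (-1) u - x * (softplus u * kern x 1 0 u))
  (J (kern x 1 (-1)) - x * softplus_moment x 1)).
{ apply is_J_minus; [apply J_kern_correct; lra|].
  apply is_J_scal, softplus_moment_correct; lra. }
assert (H3 : is_J (fun u => kern x 1 (-1) u - x * (softplus u * kern x 1 0 u)) 0).
{ apply is_J_ext with (2 := H). intros u. ring. }
generalize (is_J_inj _ _ _ H2 H3). lra.
Qed.

(** * Incomplete gamma functions and the exponential integral *)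

Lemma filter_prod_at_point_infty (x : R) (P : R -> Prop) :
  (forall t, x <= t -> P t) ->
  filter_prod (at_point x) pinf (fun ab => forall t,
    Rmin (fst ab) (snd ab) <= t <= Rmax (fst ab) (snd ab) -> P t).
Proof.
intros H. exists (fun a => a = x) (fun b => x < b).
- reflexivity.
- now exists x.
- intros a b -> Hb t. simpl. rewrite Rmin_left, Rmax_right by lra.
  intros Ht. apply H. lra.
Qed.

Lemma is_RInt_gen_half_line (F f : R -> R) (x l : R) :
  (forall t, x <= t -> is_derive F t (f t)) ->
  (forall t, x <= t -> continuous f t) ->
  filterlim F pinf (locally l) ->
  is_RInt_gen f (at_point x) pinf (l - F x).
Proof.
intros HF Hc Hl. apply (is_RInt_gen_FTC (at_point x) pinf F f (F x) l).
- apply filter_prod_at_point_infty. intros t Ht. split; auto.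
- intros P HP. exact (locally_singleton (F x) P HP).
- exact Hl.
Qed.

Lemma half_line_unique (f : R -> R) (x l : R) :
  is_RInt_gen f (at_point x) pinf l -> RInt_gen f (at_point x) pinf = l.
Proof.
exact (is_RInt_gen_unique (V := R_CompleteNormedModule)
  (Fa := at_point x) (Fb := pinf) f l).
Qed.

(** Besides the value, a primitive vanishing at [x] is returned with its limit: composing it with a
    substitution changes variables, as in [J_kern_1_m1]. *)
Lemma half_line_integral (f : R -> R) (x C : R) :
  0 < x -> (forall t, 0 < t -> continuous f t) ->
  (forall t, x <= t -> Rabs (f t) <= C * exp (- t)) ->
  is_RInt_gen f (at_point x) pinf (RInt_gen f (at_point x) pinf) /\
  exists F, (forall t, 0 < t -> is_derive F t (f t)) /\ F x = 0 /\
    filterlim F pinf (locally (RInt_gen f (at_point x) pinf)).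
Proof.
intros Hx Hc HC.
set (F := fun t => RInt f x t).
assert (HF : forall t, 0 < t -> is_derive F t (f t)).
{ intros t Ht. apply (is_derive_RInt f F x t); [|now apply Hc].
  generalize (locally_pos t Ht). apply filter_imp. intros y Hy.
  apply (RInt_correct f x y).
  apply (ex_RInt_continuous (V := R_CompleteNormedModule)). intros z Hz. apply Hc.
  eapply Rlt_le_trans; [|apply Hz]. now apply Rmin_glb_lt. }
assert (HFx : F x = 0) by (unfold F; rewrite RInt_point; reflexivity).
destruct (ex_filterlim_dominated F f (fun t => (- C) * exp (- 1 * t))
   (fun t => C * exp (- t)) x 0) as [l Hl].
- intros t Ht. split; [apply HF; lra|split; [|now apply HC]].
  auto_derive; [exact I|]. replace (-1 * t) with (- t) by ring. ring.
- apply filterlim_exp_decay. exact Rlt_0_1.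
- assert (Hi : is_RInt_gen f (at_point x) pinf l).
  { replace l with (l - F x) by (rewrite HFx; ring).
    apply is_RInt_gen_half_line; [| |exact Hl]; intros t Ht;
      [apply HF|apply Hc]; lra. }
  assert (Hl' : RInt_gen f (at_point x) pinf = l).
  { exact (half_line_unique f x l Hi). }
  rewrite Hl'. split; [exact Hi|]. now exists F.
Qed.

Lemma continuous_Rpower_exp nu t :
  0 < t -> continuous (fun t => Rpower t (nu - 1) * exp (- t)) t.
Proof.
intros Ht. unfold Rpower.
apply (ex_derive_continuous (fun t => exp ((nu - 1) * ln t) * exp (- t))).
auto_derive. exact Ht.
Qed.

(** For [nu <= 1] the power [t^(nu-1)] is nonincreasing, so its value at [x] serves as the constant
    of domination. *)
Lemma upper_gamma_correct nu x : 0 < x -> nu <= 1 ->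
  is_RInt_gen (fun t => Rpower t (nu - 1) * exp (- t)) (at_point x) pinf
    (upper_gamma nu x).
Proof.
intros Hx Hnu. unfold upper_gamma.
apply (half_line_integral _ x (Rpower x (nu - 1)) Hx (continuous_Rpower_exp nu)).
intros t Ht. rewrite Rabs_pos_eq.
- apply Rmult_le_compat_r; [left; apply exp_pos|].
  unfold Rpower. apply exp_monotone.
  assert (ln x <= ln t) by (apply ln_le; lra). nra.
- left. apply Rmult_lt_0_compat; apply exp_pos.
Qed.

Lemma upper_gamma_rec nu x : 0 < x -> nu < 1 ->
  upper_gamma nu x = (nu - 1) * upper_gamma (nu - 1) x + Rpower x (nu - 1) * exp (- x).
Proof.
intros Hx Hnu.
assert (H1 := upper_gamma_correct nu x Hx ltac:(lra)).
assert (H2 := is_RInt_gen_scal (Fa := at_point x) (Fb := pinf) _ (nu - 1) _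
  (upper_gamma_correct (nu - 1) x Hx ltac:(lra))).
assert (H3 := is_RInt_gen_minus (Fa := at_point x) (Fb := pinf) _ _ _ _ H1 H2).
set (F := fun t => - (Rpower t (nu - 1) * exp (- t))).
assert (Hlim : filterlim F pinf (locally 0)).
{ assert (HB : filterlim (fun t => Rpower x (nu - 1) * exp (- 1 * t)) pinf (locally 0)).
  { apply filterlim_exp_decay. exact Rlt_0_1. }
  apply (filterlim_le_le (F := pinf)
    (fun t => - (Rpower x (nu - 1) * exp (- 1 * t))) F (fun _ => 0) (Finite 0)).
  - exists x. intros t Ht. unfold F.
    assert (Hp : Rpower t (nu - 1) * exp (- t) <= Rpower x (nu - 1) * exp (-1 * t)).
    { replace (-1 * t) with (- t) by ring.
      apply Rmult_le_compat_r; [left; apply exp_pos|].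
      unfold Rpower. apply exp_monotone.
      assert (ln x <= ln t) by (apply ln_le; lra). nra. }
    assert (0 < Rpower t (nu - 1) * exp (- t))
      by (apply Rmult_lt_0_compat; apply exp_pos).
    lra.
  - change (filterlim (fun t => - (Rpower x (nu - 1) * exp (-1 * t))) pinf (locally 0)).
    replace 0 with (- 0) by ring.
    apply (filterlim_comp _ _ _ (fun t => Rpower x (nu - 1) * exp (-1 * t)) Ropp
      pinf (locally 0)); [exact HB|].
    apply (filterlim_opp (V := R_NormedModule) 0).
  - apply filterlim_const. }
assert (H4 := is_RInt_gen_half_line F
  (fun t => minus (Rpower t (nu - 1) * exp (- t))
     (scal (nu - 1) (Rpower t (nu - 1 - 1) * exp (- t)))) x 0).
assert (H5 : minus (upper_gamma nu x) (scal (nu - 1) (upper_gamma (nu - 1) x)) = 0 - F x).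
{ refine (eq_trans (eq_sym (half_line_unique _ _ _ H3)) _).
  apply half_line_unique.
  apply H4; [| |exact Hlim].
  - intros t Ht. unfold F. evar_last.
    + apply (is_derive_opp (fun t => Rpower t (nu - 1) * exp (- t))).
      apply (is_derive_mult (fun t => Rpower t (nu - 1)) (fun t => exp (- t)) t
        ((nu - 1) / t * Rpower t (nu - 1)) (- exp (- t))).
      * apply is_derive_Rpower_l. lra.
      * auto_derive; [exact I|ring].
      * intros; apply Rmult_comm.
    + replace (Rpower t (nu - 1 - 1)) with (Rpower t (nu - 1) * / t).
      2:{ replace (nu - 1 - 1) with ((nu - 1) + - (1)) by ring.
          rewrite Rpower_plus, Rpower_Ropp, Rpower_1 by lra. reflexivity. }
      unfold opp, minus, plus, mult, scal, opp; simpl. unfold mult; simpl.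
      field. lra.
  - intros t Ht.
    apply (continuous_minus (fun t => Rpower t (nu - 1) * exp (- t))).
    + apply continuous_Rpower_exp. lra.
    + apply (continuous_scal_r (nu - 1) (fun t => Rpower t (nu - 1 - 1) * exp (- t))).
      apply continuous_Rpower_exp. lra. }
unfold minus, plus, opp, scal in H5; simpl in H5. unfold mult, F in H5; simpl in H5.
lra.
Qed.

Lemma expint_E1_correct x : 0 < x ->
  is_RInt_gen (fun t => exp (- t) / t) (at_point x) pinf (expint_E1 x) /\
  exists F, (forall t, 0 < t -> is_derive F t (exp (- t) / t)) /\ F x = 0 /\
    filterlim F pinf (locally (expint_E1 x)).
Proof.
intros Hx. unfold expint_E1. apply (half_line_integral _ x (/ x) Hx).
- intros t Ht. apply (ex_derive_continuous (fun t => exp (- t) / t)).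
  auto_derive. lra.
- intros t Ht. assert (He := exp_pos (- t)).
  rewrite Rabs_pos_eq.
  + unfold Rdiv. rewrite Rmult_comm.
    apply Rmult_le_compat_r; [lra|]. apply Rinv_le_contravar; lra.
  + left. apply Rdiv_lt_0_compat; lra.
Qed.

Lemma upper_gamma_0 x : 0 < x -> upper_gamma 0 x = expint_E1 x.
Proof.
intros Hx. unfold upper_gamma. apply half_line_unique.
apply (is_RInt_gen_ext (Fa := at_point x) (Fb := pinf) (fun t => exp (- t) / t)
  (fun t => Rpower t (0 - 1) * exp (- t)) (expint_E1 x));
  [|now apply expint_E1_correct].
assert (H : forall t, x <= t -> exp (- t) / t = Rpower t (0 - 1) * exp (- t)).
{ intros t Ht. replace (0 - 1) with (- (1)) by ring.
  rewrite Rpower_Ropp, Rpower_1 by lra. unfold Rdiv. ring. }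
generalize (filter_prod_at_point_infty x _ H). apply filter_imp.
intros ab Hab t Ht. apply Hab. split; left; apply Ht.
Qed.

(** Substitute [s = x (1 + t)] in the integral of [exp (- x t) / (1 + t)]; the lower end becomes
    [s = x], where the primitive [F] vanishes. *)
Lemma J_kern_1_m1 x : 0 < x -> J (kern x 1 (-1)) = exp x * expint_E1 x.
Proof.
intros Hx. destruct (expint_E1_correct x Hx) as [_ [F [HF [HFx Hl]]]].
set (s := fun u => x * (1 + exp u)).
assert (Hs : forall u, 0 < s u).
{ intros u. apply Rmult_lt_0_compat; [exact Hx|apply one_plus_exp_pos]. }
assert (H : is_J (fun u => exp (- x) * kern x 1 (-1) u) (expint_E1 x - 0)).
{ apply (is_RInt_gen_FTC minf pinf (fun u => F (s u))
    (fun u => exp (- x) * kern x 1 (-1) u) 0 (expint_E1 x)).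
  - apply filter_forall. intros ab u _. split.
    + evar_last.
      * apply (is_derive_comp F s); [now apply HF|].
        unfold s. auto_derive; [exact I|reflexivity].
      * unfold scal; simpl; unfold mult; simpl.
        unfold kern.
        replace (- x * exp u + 1 * u + -1 * softplus u) with
          (- x * exp u + u + - softplus u) by ring.
        rewrite !exp_plus, (exp_Ropp (softplus u)), exp_softplus. unfold s.
        replace (- (x * (1 + exp u))) with (- x + - x * exp u) by ring.
        rewrite exp_plus. field. generalize (one_plus_exp_pos u); lra.
    + apply (continuous_scal_r (exp (- x)) (kern x 1 (-1))), continuous_kern.
  - apply (filterlim_comp _ _ _ s F minf (locally x)).
    + apply (filterlim_comp _ _ _ exp (fun y => x * (1 + y)) minf (locally 0)).
      * exact is_lim_exp_m.
      * assert (Hc : continuous (fun y => x * (1 + y)) 0).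
        { apply (ex_derive_continuous (fun y => x * (1 + y)) 0). auto_derive; exact I. }
        unfold continuous in Hc. replace (x * (1 + 0)) with x in Hc by ring. exact Hc.
    + rewrite <- HFx. apply (is_derive_continuous F x _ (HF x Hx)).
  - apply (filterlim_comp _ _ _ s F pinf pinf); [|exact Hl].
    intros P [M HM]. exists (M / x). intros u Hu. apply HM. unfold s.
    assert (Hux : M < u * x).
    { replace M with (M / x * x) by (field; lra). now apply Rmult_lt_compat_r. }
    assert (1 + u <= exp u) by apply exp_ineq1_le. nra. }
assert (H2 := is_J_inj _ _ _ H
  (is_J_scal _ (exp (- x)) _ (J_kern_correct x 1 (-1) Hx Rlt_0_1))).
rewrite exp_Ropp in H2. assert (He := exp_pos x).
apply Rmult_eq_reg_l with (/ exp x); [|apply Rinv_neq_0_compat; lra].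
rewrite <- H2. field. lra.
Qed.

Lemma Rpower_opp_nat x m : 0 < x -> Rpower x (- INR m) = / x ^ m.
Proof. intros Hx. now rewrite Rpower_Ropp, Rpower_pow. Qed.

Lemma upper_gamma_neg_rec m x : 0 < x ->
  upper_gamma (- INR m) x =
  exp (- x) / x ^ S m - INR (S m) * upper_gamma (- INR (S m)) x.
Proof.
intros Hx. rewrite upper_gamma_rec by (generalize (pos_INR m); lra).
replace (- INR m - 1) with (- INR (S m)) by (rewrite S_INR; ring).
rewrite Rpower_opp_nat by exact Hx. unfold Rdiv. ring.
Qed.

(** Splitting [t^m = t^m / (1+t) + t^(m+1) / (1+t)] shows that consecutive integrals add up to
    [m! / x^(m+1)]; the recurrence of [Gamma(-m,x)] says the same of the right-hand sides. *)
Lemma J_kern_m1 x m : 0 < x ->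
  J (kern x (INR (S m)) (-1)) = INR (fact m) * exp x * upper_gamma (- INR m) x.
Proof.
intros Hx. induction m as [|m IH].
- simpl INR. rewrite Ropp_0, upper_gamma_0, J_kern_1_m1 by exact Hx. ring.
- assert (Hm : 0 < INR (S m)) by (apply lt_0_INR; lia).
  assert (Hsum : J (kern x (INR (S m)) 0) =
    J (kern x (INR (S m)) (-1)) + J (kern x (INR (S (S m))) (-1))).
  { apply is_J_unique.
    apply is_J_ext with
      (fun u => kern x (INR (S m)) (-1) u + kern x (INR (S (S m))) (-1) u).
    - intros u. rewrite (kern_split x (INR (S m)) 0), (S_INR (S m)).
      replace (0 - 1) with (-1) by ring. reflexivity.
    - apply is_J_plus; apply J_kern_correct; auto. rewrite (S_INR (S m)). lra. }
  rewrite IH, J_kern_fact, upper_gamma_neg_rec in Hsum by exact Hx.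
  assert (He := exp_pos x).
  rewrite exp_Ropp in Hsum.
  rewrite fact_simpl, mult_INR.
  assert (Hxm : x ^ S m <> 0) by (apply pow_nonzero; lra).
  replace (INR (fact m) * exp x * (/ exp x / x ^ S m -
    INR (S m) * upper_gamma (- INR (S m)) x)) with
   (INR (fact m) / x ^ S m - INR (S m) * INR (fact m) * exp x *
    upper_gamma (- INR (S m)) x) in Hsum by (field; lra).
  lra.
Qed.

(** * Lower incomplete gamma functions and the bracket of the theorem *)

Lemma lower_gamma_correct m z :
  is_RInt (fun t => t ^ m * exp (- t)) 0 z (lower_gamma (S m) z).
Proof.
replace (lower_gamma (S m) z) with (RInt (fun t => t ^ m * exp (- t)) 0 z).
- apply (RInt_correct (V := R_CompleteNormedModule)).
  apply (ex_RInt_continuous (V := R_CompleteNormedModule)). intros t _.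
  apply (ex_derive_continuous (fun t => t ^ m * exp (- t))). auto_derive; exact I.
- unfold lower_gamma. now replace (S m - 1)%nat with m by lia.
Qed.

Lemma lower_gamma_1 z : lower_gamma 1 z = 1 - exp (- z).
Proof.
apply (eq_trans (eq_sym (is_RInt_unique _ _ _ _ (lower_gamma_correct 0 z)))).
apply is_RInt_unique.
replace (1 - exp (- z)) with (minus (- exp (- z)) (- exp (- 0))).
2:{ unfold minus, plus, opp; simpl. rewrite Ropp_0, exp_0. ring. }
apply (is_RInt_derive (fun t => - exp (- t)) (fun t => t ^ 0 * exp (- t))).
- intros t _. auto_derive; [exact I|simpl; ring].
- intros t _. apply (ex_derive_continuous (fun t => t ^ 0 * exp (- t))).
  auto_derive; exact I.
Qed.

Lemma lower_gamma_rec m z :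
  lower_gamma (S (S m)) z =
  INR (S m) * lower_gamma (S m) z - z ^ S m * exp (- z).
Proof.
assert (H : is_RInt (fun t => INR (S m) * (t ^ m * exp (- t)) - t ^ S m * exp (- t))
   0 z (z ^ S m * exp (- z))).
{ replace (z ^ S m * exp (- z)) with (minus (z ^ S m * exp (- z)) (0 ^ S m * exp (- 0))).
  2:{ unfold minus, plus, opp; simpl. ring. }
  apply (is_RInt_derive (fun t => t ^ S m * exp (- t))
    (fun t => INR (S m) * (t ^ m * exp (- t)) - t ^ S m * exp (- t))).
  - intros t _. auto_derive; [exact I|]. simpl. ring.
  - intros t _.
    apply (ex_derive_continuous
      (fun t => INR (S m) * (t ^ m * exp (- t)) - t ^ S m * exp (- t))).
    auto_derive; exact I. }
assert (H2 := is_RInt_minus _ _ _ _ _ _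
  (is_RInt_scal _ _ _ (INR (S m)) _ (lower_gamma_correct m z))
  (lower_gamma_correct (S m) z)).
assert (H3 := eq_trans (eq_sym (is_RInt_unique _ _ _ _ H)) (is_RInt_unique _ _ _ _ H2)).
unfold minus, plus, opp, scal in H3. cbn -[INR pow lower_gamma] in H3.
unfold mult in H3; cbn -[INR pow lower_gamma] in H3.
lra.
Qed.

(** Shifting by [x] carries [gamma(m+1,-x)], an integral over a negative interval, to [[0, x]],
    where it meets the integrals [gamma(l,x)]. *)
Lemma lower_gamma_translate m x :
  is_RInt (fun t => (t - x) ^ m * exp (- t)) 0 x
    (- (exp (- x) * lower_gamma (S m) (- x))).
Proof.
apply (is_RInt_swap (V := R_NormedModule)).
apply is_RInt_ext with
  (fun t => scal (exp (- x)) (scal 1 ((1 * t + - x) ^ m * exp (- (1 * t + - x))))).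
- intros t _. unfold scal; simpl; unfold mult; simpl.
  rewrite !Rmult_1_l. replace (- (t + - x)) with (- t + x) by ring.
  rewrite exp_plus, (exp_Ropp x). unfold Rminus. field. apply Rgt_not_eq, exp_pos.
- apply (is_RInt_scal (fun t => scal 1 ((1 * t + - x) ^ m * exp (- (1 * t + - x))))
    x 0 (exp (- x)) (lower_gamma (S m) (- x))).
  apply (is_RInt_comp_lin (fun t => t ^ m * exp (- t)) 1 (- x) x 0).
  replace (1 * x + - x) with 0 by ring. replace (1 * 0 + - x) with (- x) by ring.
  apply lower_gamma_correct.
Qed.

Lemma is_RInt_sum_n (f : nat -> R -> R) (v : nat -> R) (a b : R) (m : nat) :
  (forall i, is_RInt (f i) a b (v i)) ->
  is_RInt (fun t => sum_n (fun i => f i t) m) a b (sum_n v m).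
Proof.
intros H. induction m as [|m IH].
- rewrite sum_O. apply is_RInt_ext with (f O); [|apply H].
  intros t _. now rewrite sum_O.
- rewrite sum_Sn. apply is_RInt_ext with
    (fun t => plus (sum_n (fun i => f i t) m) (f (S m) t)).
  { intros t _. now rewrite sum_Sn. }
  now apply (is_RInt_plus (V := R_NormedModule)).
Qed.

Lemma is_J_sum_n (f : nat -> R -> R) (v : nat -> R) (m : nat) :
  (forall i, is_J (f i) (v i)) -> is_J (fun t => sum_n (fun i => f i t) m) (sum_n v m).
Proof.
intros H. induction m as [|m IH].
- rewrite sum_O. apply is_J_ext with (f O); [|apply H].
  intros t. now rewrite sum_O.
- rewrite sum_Sn. apply is_J_ext with
    (fun t => sum_n (fun i => f i t) m + f (S m) t).
  { intros t. now rewrite sum_Sn. }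
  now apply is_J_plus.
Qed.

(** Expand [(t - x)^m] under the integral of [lower_gamma_translate] and divide by [(- x)^(m+1)]. *)
Lemma binomial_sum_lower_gamma m x : 0 < x ->
  sum_n (fun i => Binomial.C m i * (/ (- x) ^ S i * lower_gamma (S i) x)) m =
  - (/ (- x) ^ S m * exp (- x) * lower_gamma (S m) (- x)).
Proof.
intros Hx. assert (Hx0 : - x <> 0) by lra.
assert (H1 : is_RInt (fun t => sum_n (fun i =>
   scal (Binomial.C m i * / (- x) ^ S i) (t ^ i * exp (- t))) m) 0 x
  (sum_n (fun i => scal (Binomial.C m i * / (- x) ^ S i) (lower_gamma (S i) x)) m)).
{ apply (is_RInt_sum_n (fun i t => scal (Binomial.C m i * / (- x) ^ S i) (t ^ i * exp (- t)))).
  intros i.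
  apply (is_RInt_scal (fun t => t ^ i * exp (- t)) 0 x (Binomial.C m i * / (- x) ^ S i)).
  apply lower_gamma_correct. }
assert (H2 := is_RInt_scal _ _ _ (/ (- x) ^ S m) _ (lower_gamma_translate m x)).
transitivity (RInt (fun t => sum_n (fun i =>
   scal (Binomial.C m i * / (- x) ^ S i) (t ^ i * exp (- t))) m) 0 x).
{ rewrite (is_RInt_unique _ _ _ _ H1). apply sum_n_ext. intros i.
  unfold scal, mult; cbn -[pow lower_gamma Binomial.C]. ring. }
transitivity (scal (/ (- x) ^ S m) (- (exp (- x) * lower_gamma (S m) (- x)))).
2:{ unfold scal, mult; cbn -[pow lower_gamma]. unfold mult; cbn -[pow lower_gamma]. ring. }
apply is_RInt_unique. apply is_RInt_ext with (2 := H2).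
intros t _. unfold Rminus. rewrite binomial, <- sum_n_Reals.
transitivity (scal (/ (- x) ^ S m * exp (- t))
  (sum_n (fun i => Binomial.C m i * t ^ i * (- x) ^ (m - i)) m)).
{ unfold scal, mult; cbn -[pow sum_n]. unfold mult; cbn -[pow sum_n]. ring. }
rewrite <- (sum_n_scal_l (V := R_NormedModule)).
apply sum_n_ext_loc. intros i Hi.
unfold scal, mult; cbn -[pow Binomial.C]. unfold mult; cbn -[pow Binomial.C].
rewrite <- !tech_pow_Rmult.
replace ((- x) ^ m) with ((- x) ^ (m - i) * (- x) ^ i)
  by (rewrite <- pow_add; f_equal; lia).
field. repeat split; try (apply pow_nonzero); lra.
Qed.

Lemma pascal_sum (y : nat -> R) (m : nat) :
  sum_n_m (fun l => Binomial.C (S m) l * y l) 1 (S m) =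
  sum_n_m (fun l => Binomial.C m l * y l) 1 m
  + sum_n (fun i => Binomial.C m i * y (S i)) m.
Proof.
rewrite <- (sum_n_m_S (fun l => Binomial.C (S m) l * y l)).
fold (sum_n (fun i => Binomial.C (S m) (S i) * y (S i)) m).
assert (HC : forall k, Binomial.C k k = 1).
{ intros k. unfold Binomial.C. rewrite Nat.sub_diag. simpl. field.
  apply INR_fact_neq_0. }
(* For positive [m] the top index is split off: Pascal's rule is out of range there, and both
   coefficients equal 1. *)
destruct m as [|m].
- rewrite sum_n_m_zero by lia. rewrite !sum_O, !HC. unfold zero; simpl.
  unfold Binomial.C; simpl. field.
- rewrite <- (sum_n_m_S (fun l => Binomial.C (S m) l * y l)).
  fold (sum_n (fun i => Binomial.C (S m) (S i) * y (S i)) m).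
  rewrite (sum_Sn (fun i => Binomial.C (S (S m)) (S i) * y (S i))).
  rewrite (sum_Sn (fun i => Binomial.C (S m) i * y (S i))). rewrite !HC.
  rewrite (sum_n_ext_loc (fun i => Binomial.C (S (S m)) (S i) * y (S i))
    (fun i => plus (Binomial.C (S m) (S i) * y (S i)) (Binomial.C (S m) i * y (S i)))).
  2:{ intros i Hi. rewrite <- pascal by lia. unfold plus; simpl. ring. }
  rewrite sum_n_plus. unfold plus; cbn -[sum_n Binomial.C]. ring.
Qed.

(** The braces of the theorem without [H_(n+k)]; they depend on [n + k] alone, which permits
    induction on [m = n + k]. *)
Definition gamma_bracket (x : R) (m : nat) : R :=
  (-1) ^ (m + 1) * upper_gamma (- INR m) x * lower_gamma (m + 1) (- x)
  - sum_n_m (fun l => Binomial.C m l * / (- x) ^ l * lower_gamma l x) 1 m.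

(** The sum is empty and [- gamma(1,-x) = e^x - 1], so [E_1(x)] completes the bracket to
    [e^x E_1(x)]. *)
Lemma gamma_bracket_0 x : 0 < x ->
  expint_E1 x + gamma_bracket x 0 = exp x * expint_E1 x.
Proof.
intros Hx. unfold gamma_bracket. rewrite sum_n_m_zero by lia.
simpl. rewrite Ropp_0, upper_gamma_0, lower_gamma_1, Ropp_involutive by exact Hx.
unfold zero; simpl. ring.
Qed.

(** The boundary term in the recurrence of [gamma(m+2,-x)] is the increment. That of [Gamma(-m,x)],
    namely [e^(-x) / x^(m+1)], multiplies [gamma(m+1,-x)] and matches the terms that Pascal's rule
    adds to the sum. *)
Lemma gamma_bracket_succ x m : 0 < x ->
  gamma_bracket x (S m) =
  gamma_bracket x m + x ^ S m * exp x * upper_gamma (- INR (S m)) x.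
Proof.
intros Hx. unfold gamma_bracket.
replace (S m + 1)%nat with (S (S m)) by lia. replace (m + 1)%nat with (S m) by lia.
assert (HC : forall k, sum_n_m (fun l => Binomial.C k l * / (- x) ^ l * lower_gamma l x) 1 k =
  sum_n_m (fun l => Binomial.C k l * (/ (- x) ^ l * lower_gamma l x)) 1 k).
{ intros k. apply sum_n_m_ext. intros l. apply Rmult_assoc. }
rewrite !HC.
rewrite (pascal_sum (fun l => / (- x) ^ l * lower_gamma l x)).
rewrite binomial_sum_lower_gamma by exact Hx.
rewrite lower_gamma_rec, (upper_gamma_neg_rec m x Hx), Ropp_involutive.
assert (Hs : (-1) ^ S m * (-1) ^ S m = 1).
{ rewrite <- Rpow_mult_distr. replace (-1 * -1) with 1 by ring. apply pow1. }
assert (Hmx : (- x) ^ S m = (-1) ^ S m * x ^ S m).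
{ rewrite <- Rpow_mult_distr. f_equal. ring. }
rewrite Hmx.
assert (Hxm : x ^ S m <> 0) by (apply pow_nonzero; lra).
assert (Hsn : (-1) ^ S m <> 0) by (apply pow_nonzero; lra).
replace (/ ((-1) ^ S m * x ^ S m)) with ((-1) ^ S m / x ^ S m).
2:{ rewrite Rinv_mult. unfold Rdiv. f_equal.
    apply Rmult_eq_reg_l with ((-1) ^ S m); [|exact Hsn].
    rewrite Rinv_r by exact Hsn. exact Hs. }
replace ((-1) ^ S (S m)) with (- (-1) ^ S m) by (simpl; ring).
set (s := (-1) ^ S m) in *. set (X := x ^ S m) in *.
set (g := upper_gamma (- INR (S m)) x). set (l := lower_gamma (S m) (- x)).
set (sm := sum_n_m _ 1 m).
transitivity ((s * s) * g * X * exp x + (s * (exp (- x) / X - INR (S m) * g) * l - sm)).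
- field. exact Hxm.
- rewrite Hs. ring.
Qed.

Lemma softplus_moment_fact x m : 0 < x ->
  softplus_moment x (INR (S m)) =
  INR (fact m) / x ^ S m * (expint_E1 x + gamma_bracket x m).
Proof.
intros Hx. induction m as [|m IH].
- rewrite gamma_bracket_0, <- J_kern_1_m1, <- softplus_moment_1 by exact Hx.
  simpl. field. lra.
- assert (Hm : 0 < INR (S m)) by (apply lt_0_INR; lia).
  rewrite gamma_bracket_succ by exact Hx.
  apply Rmult_eq_reg_l with x; [|lra].
  rewrite (S_INR (S m)), softplus_moment_succ, IH, <- (S_INR (S m)), J_kern_m1
    by assumption.
  rewrite fact_simpl, mult_INR. rewrite <- (tech_pow_Rmult x (S m)).
  field. split; [apply pow_nonzero|]; lra.
Qed.

(** * Binomial expansion of the kernel at integer exponents *)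

Lemma pow_exp u k : exp u ^ k = exp (INR k * u).
Proof.
rewrite <- Rpower_pow by apply exp_pos. unfold Rpower. now rewrite ln_exp.
Qed.

Lemma kern_binomial x n u :
  kern x (INR n + 1) (INR n) u =
  sum_n (fun k => Binomial.C n k * kern x (INR (S (n + k))) 0 u) n.
Proof.
transitivity (kern x (INR n + 1) 0 u *
  sum_n (fun k => Binomial.C n k * exp u ^ k * 1 ^ (n - k)) n).
- rewrite sum_n_Reals, <- binomial, (Rplus_comm (exp u) 1), <- exp_softplus, pow_exp.
  unfold kern. rewrite <- exp_plus. f_equal. ring.
- change (scal (kern x (INR n + 1) 0 u)
    (sum_n (fun k => Binomial.C n k * exp u ^ k * 1 ^ (n - k)) n) =
    sum_n (fun k => Binomial.C n k * kern x (INR (S (n + k))) 0 u) n).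
  rewrite <- (sum_n_scal_l (V := R_NormedModule)). apply sum_n_ext. intros k.
  change (kern x (INR n + 1) 0 u * (Binomial.C n k * exp u ^ k * 1 ^ (n - k)) =
    Binomial.C n k * kern x (INR (S (n + k))) 0 u).
  rewrite pow1, pow_exp, S_INR, plus_INR. unfold kern.
  replace (- x * exp u + (INR n + INR k + 1) * u + 0 * softplus u) with
   ((- x * exp u + (INR n + 1) * u + 0 * softplus u) + INR k * u) by ring.
  rewrite (exp_plus _ (INR k * u)). ring.
Qed.

(** * The derivative at half-integers *)

(* Equations between sums live in the carrier of [R_AbelianMonoid], which [ring]
   and [field] do not recognise as [R]. *)
Ltac eqR := match goal with |- @eq _ ?a ?b => change (@eq R a b) end.

Lemma sum_n_linear (K A : R) (f g : nat -> R) (n : nat) :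
  K * (A * sum_n f n + sum_n g n) = sum_n (fun k => K * (A * f k + g k)) n.
Proof.
induction n as [|n IH].
- now rewrite !sum_O.
- rewrite !sum_Sn, <- IH. unfold plus; cbn -[sum_n]. ring.
Qed.

(** The terms of the Bessel polynomial in [1 / x]: [e^(-x/2)] times their sum over [k <= n] is
    [sqrt (x / PI) * K_(n+1/2)(x/2)]. *)
Definition bessel_coef (n : nat) (x : R) (k : nat) : R :=
  INR (fact (n + k)) * / x ^ k / (INR (fact k) * INR (fact (n - k))).

Lemma J_kern_integer x n : 0 < x ->
  J (kern x (INR n + 1) (INR n)) =
  INR (fact n) / x ^ S n * sum_n (bessel_coef n x) n.
Proof.
intros Hx.
rewrite (J_eq _ _ (kern_binomial x n)).
transitivity (sum_n (fun k => Binomial.C n k * (INR (fact (n + k)) / x ^ S (n + k))) n).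
- apply is_J_unique.
  apply (is_J_sum_n (fun k u => Binomial.C n k * kern x (INR (S (n + k))) 0 u)).
  intros k. apply is_J_scal. rewrite <- J_kern_fact by exact Hx.
  apply J_kern_correct; [exact Hx|]. apply lt_0_INR. lia.
(* Taking [A = 1] and a zero second sum brings a single sum into the shape of [sum_n_linear]. *)
- replace (sum_n (bessel_coef n x) n) with
    (1 * sum_n (bessel_coef n x) n + sum_n (fun _ => 0) n).
  2:{ rewrite sum_n_const. ring. }
  rewrite sum_n_linear. apply sum_n_ext_loc. intros k Hk.
  unfold Binomial.C, bessel_coef.
  replace (x ^ S (n + k)) with (x ^ S n * x ^ k)
    by (rewrite <- pow_add; f_equal; lia).
  assert (x ^ k <> 0) by (apply pow_nonzero; lra).
  assert (x ^ S n <> 0) by (apply pow_nonzero; lra).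
  eqR; field. repeat split; auto using INR_fact_neq_0.
Qed.

(** The factor [u + softplus u = ln (t (1+t))] is brought down by differentiating [(t (1+t))^(a-1)];
    its two parts give the moments of [ln t] and of [ln (1+t)]. *)
Lemma J_log_kern_integer x n : 0 < x ->
  J (fun u => (u + 1 * softplus u) * kern x (INR n + 1) (1 * (INR n + 1 - 1)) u) =
  INR (fact n) / x ^ S n *
  sum_n (fun k => bessel_coef n x k *
    (harmonic (n + k) + log_moment 1 1 - ln x + expint_E1 x + gamma_bracket x (n + k))) n.
Proof.
intros Hx.
rewrite (J_eq _ (fun u => sum_n (fun k => Binomial.C n k *
  (u * kern x (INR (S (n + k))) 0 u + softplus u * kern x (INR (S (n + k))) 0 u)) n)).
2:{ intros u. replace (1 * (INR n + 1 - 1)) with (INR n) by ring.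
    rewrite kern_binomial.
    change (scal (u + 1 * softplus u)
     (sum_n (fun k => Binomial.C n k * kern x (INR (S (n + k))) 0 u) n) =
     sum_n (fun k => Binomial.C n k *
  (u * kern x (INR (S (n + k))) 0 u + softplus u * kern x (INR (S (n + k))) 0 u)) n).
    rewrite <- (sum_n_scal_l (V := R_NormedModule)). apply sum_n_ext. intros k.
    change ((u + 1 * softplus u) * (Binomial.C n k * kern x (INR (S (n + k))) 0 u) =
      Binomial.C n k * (u * kern x (INR (S (n + k))) 0 u +
        softplus u * kern x (INR (S (n + k))) 0 u)).
    ring. }
transitivity (sum_n (fun k => Binomial.C n k *
  (log_moment x (INR (S (n + k))) + softplus_moment x (INR (S (n + k))))) n).
- apply is_J_unique.
  apply (is_J_sum_n (fun k u => Binomial.C n k *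
  (u * kern x (INR (S (n + k))) 0 u + softplus u * kern x (INR (S (n + k))) 0 u))).
  intros k. apply is_J_scal.
  assert (0 < INR (S (n + k))) by (apply lt_0_INR; lia).
  apply is_J_plus; [now apply log_moment_correct|now apply softplus_moment_correct].
- match goal with |- _ = ?K * ?S =>
    transitivity (K * (1 * S + sum_n (fun _ => 0) n));
    [|rewrite sum_n_const; ring] end.
  rewrite sum_n_linear. apply sum_n_ext_loc. intros k Hk.
  rewrite log_moment_fact, softplus_moment_fact, log_moment_1 by exact Hx.
  unfold Binomial.C, bessel_coef.
  replace (x ^ S (n + k)) with (x ^ S n * x ^ k)
    by (rewrite <- pow_add; f_equal; lia).
  assert (x ^ k <> 0) by (apply pow_nonzero; lra).
  assert (x ^ S n <> 0) by (apply pow_nonzero; lra).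
  eqR; field. repeat split; auto using INR_fact_neq_0.
Qed.

Lemma whittakerW_half_integer n x : 0 < x ->
  whittakerW 0 (INR n + 1 / 2) x = exp (- x / 2) * sum_n (bessel_coef n x) n.
Proof.
intros Hx. assert (Hn := pos_INR n).
rewrite whittakerW_laplace by lra.
replace (INR n + 1 / 2 + 1 / 2) with (INR n + 1) by field.
unfold laplaceU.
replace (2 * (INR n + 1) - (INR n + 1) - 1) with (INR n) by ring.
rewrite J_kern_integer by exact Hx. rewrite <- !S_INR, J_kern_fact, pow1 by lra.
rewrite Rpower_pow by exact Hx.
assert (x ^ S n <> 0) by (apply pow_nonzero; lra).
field. split; auto using INR_fact_neq_0.
Qed.

Lemma is_derive_whittakerW n x : 0 < x ->
  is_derive (fun mu => whittakerW 0 mu x) (INR n + 1 / 2)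
    (exp (- x / 2) * sum_n (fun k => bessel_coef n x k *
       (expint_E1 x - harmonic n + (harmonic (n + k) + gamma_bracket x (n + k)))) n).
Proof.
intros Hx. assert (Hn := pos_INR n).
set (N := fun a => J (kern x a (1 * (a - 1)))).
set (G := fun a => J (kern 1 a (0 * (a - 1)))).
set (a0 := INR n + 1).
assert (Ha0 : 0 < a0) by (unfold a0; lra).
set (dN := J (fun u => (u + 1 * softplus u) * kern x a0 (1 * (a0 - 1)) u)).
set (dG := J (fun u => (u + 0 * softplus u) * kern 1 a0 (0 * (a0 - 1)) u)).
assert (HN : is_derive N a0 dN) by (now apply is_derive_J_kern_a).
assert (HG : is_derive G a0 dG) by (apply is_derive_J_kern_a; lra).
assert (HG0 : G a0 = INR (fact n)).
{ unfold G, a0. rewrite Rmult_0_l, <- S_INR, J_kern_fact, pow1 by lra. field. }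
assert (HdG : dG = INR (fact n) * (harmonic n + log_moment 1 1)).
{ unfold dG. transitivity (log_moment 1 a0).
  - apply J_eq. intros u. rewrite !Rmult_0_l, Rplus_0_r. reflexivity.
  - unfold a0. rewrite <- S_INR, log_moment_fact, pow1 by lra. field. }
assert (HGp : 0 < INR (fact n)) by apply INR_fact_pos.
assert (HR : is_derive (fun a => exp (- x / 2) * Rpower x a) a0
   (exp (- x / 2) * (ln x * Rpower x a0))).
{ unfold Rpower. auto_derive; [exact I|]. ring. }
set (D := exp (- x / 2) * (ln x * Rpower x a0) * (N a0 / G a0) +
   exp (- x / 2) * Rpower x a0 * ((dN * G a0 - N a0 * dG) / G a0 ^ 2)).
assert (Hf : is_derive (fun a => exp (- x / 2) * Rpower x a * (N a / G a)) a0 D).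
{ apply (is_derive_mult (fun a => exp (- x / 2) * Rpower x a) (fun a => N a / G a)).
  - exact HR.
  - apply (is_derive_div N G); [exact HN|exact HG|]. rewrite HG0. lra.
  - intros; apply Rmult_comm. }
assert (Hc : is_derive (fun mu => exp (- x / 2) * Rpower x (mu + 1 / 2) *
    (N (mu + 1 / 2) / G (mu + 1 / 2))) (INR n + 1 / 2) D).
{ evar_last.
  - apply (is_derive_comp (fun a => exp (- x / 2) * Rpower x a * (N a / G a))
      (fun mu => mu + 1 / 2) (INR n + 1 / 2) D 1).
    + replace (INR n + 1 / 2 + 1 / 2) with a0 by (unfold a0; field). exact Hf.
    + auto_derive; [exact I|ring].
  - apply Rmult_1_l. }
evar_last.
- apply is_derive_ext_loc with (2 := Hc).
  assert (Hloc : locally (INR n + 1 / 2) (fun mu => 0 < mu)) by (apply locally_pos; lra).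
  revert Hloc. apply filter_imp. intros mu Hmu.
  rewrite whittakerW_laplace by lra. unfold laplaceU, N, G. f_equal. f_equal.
  + f_equal. f_equal. ring.
  + f_equal. f_equal. ring.
- unfold D. rewrite HG0, HdG.
  assert (HNv : N a0 = INR (fact n) / x ^ S n * sum_n (bessel_coef n x) n).
  { rewrite <- J_kern_integer by exact Hx. unfold N, a0. do 2 f_equal. ring. }
  assert (HdNv := J_log_kern_integer x n Hx). fold a0 in HdNv. fold dN in HdNv.
  rewrite HNv, HdNv.
  unfold a0. rewrite <- S_INR, Rpower_pow by exact Hx.
  assert (Hxp : x ^ S n <> 0) by (apply pow_nonzero; lra).
  match goal with |- _ = _ * ?S => set (S0 := S) end.
  set (S1 := sum_n (bessel_coef n x) n).
  set (S2 := sum_n (fun k => bessel_coef n x k * (harmonic (n + k) + log_moment 1 1 -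
    ln x + expint_E1 x + gamma_bracket x (n + k))) n).
  (* [ln x] comes from the power of [x], and [- harmonic n - log_moment 1 1] from [1 / Gamma(a)];
     [ln x] and [log_moment 1 1] cancel against the terms inside [S2]. *)
  assert (HS : S0 = 1 * ((ln x - harmonic n - log_moment 1 1) * S1 + S2)).
  { unfold S0, S1, S2. rewrite sum_n_linear. apply sum_n_ext. intros k. eqR; ring. }
  rewrite HS. field. split; [exact Hxp|lra].
Qed.

Theorem theorem31 (n : nat) (x : R) (hx : 0 < x)
  (s : R) (hs : s = 1 \/ s = -1) :
  is_derive (fun mu : R => whittakerW 0 mu x) (s * (INR n + 1 / 2))
    (s * (sqrt (x / PI) * besselK (INR n + 1 / 2) (x / 2)
          * (expint_E1 x - harmonic n))
     + s * (exp (- x / 2)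
       * sum_n_m (fun k : nat =>
           INR (fact (n + k)) * / x ^ k / (INR (fact k) * INR (fact (n - k)))
           * (harmonic (n + k)
              + (-1) ^ (n + k + 1) * upper_gamma (- INR n - INR k) x
                * lower_gamma (n + k + 1) (- x)
              - sum_n_m (fun l : nat =>
                  Binomial.C (n + k) l * / (- x) ^ l * lower_gamma l x)
                  1 (n + k)))
         0 n)).
Proof.
assert (Hn := pos_INR n).
rewrite besselK_whittakerW, whittakerW_half_integer by lra.
match goal with |- is_derive _ _ (_ + s * (_ * ?S)) => set (T := S) end.
assert (HT : T = sum_n (fun k => bessel_coef n x k *
   (harmonic (n + k) + gamma_bracket x (n + k))) n).
{ apply sum_n_m_ext. intros k. unfold bessel_coef, gamma_bracket. f_equal.
  rewrite plus_INR, Ropp_plus_distr. unfold Rminus. ring. }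
set (D := exp (- x / 2) * sum_n (fun k => bessel_coef n x k *
   (expint_E1 x - harmonic n + (harmonic (n + k) + gamma_bracket x (n + k)))) n).
assert (HD : D = exp (- x / 2) * sum_n (bessel_coef n x) n *
   (expint_E1 x - harmonic n) + exp (- x / 2) * T).
{ rewrite HT. unfold D.
  transitivity (exp (- x / 2) * ((expint_E1 x - harmonic n) * sum_n (bessel_coef n x) n +
   sum_n (fun k => bessel_coef n x k * (harmonic (n + k) + gamma_bracket x (n + k))) n)).
  - rewrite sum_n_linear.
    rewrite <- (sum_n_mult_l (K := R_Ring) (exp (- x / 2))).
    apply sum_n_ext. intros k. unfold mult; cbn -[harmonic gamma_bracket bessel_coef]. eqR; ring.
  - ring. }
assert (HW := is_derive_whittakerW n x hx). fold D in HW.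
destruct hs as [-> | ->].
- rewrite !Rmult_1_l, <- HD. exact HW.
- replace (-1 * (_ * _) + -1 * _) with (- D) by (rewrite HD; ring).
  replace (-1 * (INR n + 1 / 2)) with (- (INR n + 1 / 2)) by ring.
  (* Near the negative point, evenness presents [W] as a composition with [Ropp], whose derivative
     [-1] is the sign [s]. *)
  apply is_derive_ext_loc with (fun mu => whittakerW 0 (- mu) x).
  + assert (Hloc : locally (- (INR n + 1 / 2)) (fun mu => mu < 0))
      by (apply (open_lt 0); lra).
    revert Hloc. apply filter_imp. intros mu Hmu.
    rewrite <- (Ropp_involutive mu) at 2. symmetry. apply whittakerW_even; lra.
  + evar_last.
    * apply (is_derive_comp (fun mu => whittakerW 0 mu x) Ropp _ D (-1)).
      -- rewrite Ropp_involutive. exact HW.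
      -- auto_derive; [exact I|ring].
    * unfold scal; simpl; unfold mult; simpl. ring.
Qed.
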